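(* Let $k$ be an algebraically closed field, let $d,n,r\ge 0$ be integers with $r<n$, and let $(\delta,a,b)\ne(\delta',a',b')$ be elements of $\mathcal F$ indexing $T$-fixed points of the quot scheme $\mathcal Q_d=\mathcal Q_d(r,n)$. Let $\mathcal S$ be a subsheaf of $\mathcal O^n_{\mathbb P^1\times\mathbb P^1}$ of type I, II, or III associated with $(\delta,a,b)$ and $(\delta',a',b')$, as defined in the context. Then $\mathcal S$ is $T$-invariant and is locally free of rank $n-r$ and degree $(-d,-1)$. Moreover $\mathcal S(1,0)=\mathcal S_{(\delta,a,b)}$ and $\mathcal S(0,1)=\mathcal S_{(\delta',a',b')}$, and hence $\mathcal S$ defines a $T$-invariant curve on $\mathcal Q_d$.
   Context: $\mathcal Q_d(r,n)$ is the quot scheme over $k$ parametrizing quotient sheaves on $\mathbb P^1$ of $\mathcal O_{\mathbb P^1}^n=k^n\otimes\mathcal O_{\mathbb P^1}$ of rank $r$ and degree $d$; a point is identified with the kernel subsheaf, locally free of rank $n-r$ and degree $-d$. $k^n$ has basis $\mathbf e_1,\dots,\mathbf e_n$; $[x,y]$ are coordinates on $\mathbb P^1$ with $x$ vanishing at $0$, $y$ at $\infty$. $T=T_{k^n}\times T_{\mathbb P^1}$, with $T_{k^n}=(\mathbb G_m)^n$ diagonal on $k^n$ and $T_{\mathbb P^1}=\mathbb G_m$ acting by $q\cdot x=qx$, $q\cdot y=y$. $\mathcal F$ is the set of triples $(\delta,a,b)$ with $\delta\in\{0,1\}^n$, $\sum_i\delta_i=n-r$, $a,b\in(\mathbb Z_{\ge0})^n$,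 $\sum_i(a_i+b_i)=d$, and $a_i=b_i=0$ whenever $\delta_i=0$. The corresponding $T$-fixed point is the subsheaf $\mathcal S_{(\delta,a,b)}=\bigoplus_{\delta_i=1}\mathcal S_{a_i,b_i}\cdot\mathbf e_i\subset\mathcal O^n_{\mathbb P^1}$, where $\mathcal S_{a,b}$ is the image of $\mathcal O_{\mathbb P^1}(-a-b)\xrightarrow{x^ay^b}\mathcal O_{\mathbb P^1}$. Let $[s,t]$ be coordinates on a second $\mathbb P^1$ and write $\mathcal O$ for the structure sheaf of $\mathbb P^1_{[x,y]}\times\mathbb P^1_{[s,t]}$. Sheaves over $\mathcal O$ correspond to saturated bigraded modules over $k[x,y][s,t]$; subsheaves below are described by bihomogeneous generators. For $\mathcal S\subset\mathcal O^n$, $\mathcal S(s,t)$ denotes its fibre over $[s,t]$, a subsheaf of $\mathcal O_{\mathbb P^1}^n$. A $T$-invariant curve on $\mathcal Q_d$ is a flat family over $\mathbb P^1_{[s,t]}$, with $T$-action, whose fibres are locally free subsheaves of $\mathcal O_{\mathbb P^1}^n$ of rank $n-r$ and degree $-d$ (defining a point of $\mathcal Q_d$). $T$-invariance of $\mathcal S$ means that $T$ acts on $\mathbb P^1_{[s,t]}$ (by scaling the coordinates $s,t$) so that $\mathcal S$ is preserved by the resulting action of $T$ on $\mathcal O^n$. In each type, $\mathcal S$ agrees with both (pullbacks of) $\mathcal S_{(\delta,a,b)}$ and $\mathcal S_{(\delta',a',b')}$ outside the indicated components. Type I: $(\delta,a,b)$ and $(\delta',a',b')$ agree except in positions $i$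 and $j$, with $\delta_i=\delta'_j=1$ and $\delta_j=\delta'_i=0$ (so $a_i+b_i=a'_j+b'_j$). The component of $\mathcal S$ in $\mathcal O\mathbf e_i+\mathcal O\mathbf e_j$ is generated by $s x^{a_i}y^{b_i}\mathbf e_i+t x^{a'_j}y^{b'_j}\mathbf e_j$. Type II, first kind: $\delta=\delta'$, $b=b'$, and $a,a'$ agree except in positions $i\ne j$, chosen so that $a_i<a'_i$. Put $c=a'_i-a_i=a_j-a'_j>0$ and $\gamma=a_i+b_i+c-a_j-b_j$. The component of $\mathcal S$ in $\mathcal O\mathbf e_i+\mathcal O\mathbf e_j$ is generated by $x^{a_i+c}y^{b_i}\mathbf e_i$, $x^{a_j}y^{b_j}\mathbf e_j$, and a third generator, which is $s x^{a_i}y^{b_i}\mathbf e_i+t x^{a_j-c}y^{b_j+\gamma}\mathbf e_j$ if $\gamma\ge0$, and $s x^{a_i}y^{b_i-\gamma}\mathbf e_i+t x^{a_j-c}y^{b_j}\mathbf e_j$ if $\gamma<0$. Type II, second kind: $\delta=\delta'$, $a=a'$, and $b,b'$ agree except in positions $i\neq j$, with $c=b'_i-b_i=b_j-b'_j>0$; put $\gamma=a_i+b_i+c-a_j-b_j$. The component of $\mathcal S$ in $\mathcal O\mathbf e_i+\mathcal O\mathbf e_j$ is generated by $x^{a_i}y^{b_i+c}\mathbf e_i$, $x^{a_j}y^{b_j}\mathbf e_j$, and a third generator, which is $s x^{a_i}y^{b_i}\mathbf e_i+t x^{a_j+\gamma}y^{b_j-c}\mathbf e_j$ if $\gamma\ge0$,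 and $s x^{a_i-\gamma}y^{b_i}\mathbf e_i+t x^{a_j}y^{b_j-c}\mathbf e_j$ if $\gamma<0$. Type III: $\delta=\delta'$ and $(a,b)$, $(a',b')$ agree except in position $i$ (so $\delta_i=1$ and $a_i+b_i=a'_i+b'_i$). The component of $\mathcal S$ in $\mathcal O\mathbf e_i$ is generated by $(s x^{a_i}y^{b_i}+t x^{a'_i}y^{b'_i})\mathbf e_i$.
   Formalization: For type II the degree of S is stated and proved as (-d,0), because the printed (-d,-1) is false there: for n=2, r=0, d=1, S=<x e_1, x e_2, s e_1 + t e_2> has determinant O(-1,0). Types I and III keep degree (-d,-1). *)

(* Defs.v *)
From HB Require Import structures.
From mathcomp Require Import all_boot all_order all_algebra.
From mathcomp Require Import fraction mpoly.

Set Implicit Arguments.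
Unset Strict Implicit.
Unset Printing Implicit Defensive.
Import GRing.Theory.
Local Open Scope ring_scope.

(** * Subsheaves of O^n on (P^1)^g

    The homogeneous coordinate ring of (P^1)^g over k is {mpoly k[g.*2]}; the
    c-th factor has homogeneous coordinates 'X_(crd0 c), 'X_(crd1 c), and the
    grading is by N^g.  Only g = 1 and g = 2 are used: on P^1 the coordinates
    [x,y] are those of factor 0, and on P^1_[x,y] x P^1_[s,t] the coordinates
    [s,t] are those of factor 1.

    A subsheaf of O^n is given by a graded submodule M of the free module of
    rank n.  Different graded modules may define the same sheaf, so sheaves are
    compared through their stalks.  The field k is meant to be algebraically
    closed, and (P^1)^g is treated as a variety through its closed points. *)

Lemma crd0_subproof g (c : 'I_g) : (c.*2 < g.*2)%N.
Proof. by rewrite ltn_double. Qed.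
Lemma crd1_subproof g (c : 'I_g) : (c.*2.+1 < g.*2)%N.
Proof. by rewrite ltn_Sdouble. Qed.
Definition crd0 g (c : 'I_g) : 'I_(g.*2) := Ordinal (crd0_subproof c).
Definition crd1 g (c : 'I_g) : 'I_(g.*2) := Ordinal (crd1_subproof c).

Section Sheaves.
Variables (k : fieldType) (g : nat).

Local Notation R := {mpoly k[g.*2]}.
Local Notation K := {fraction {mpoly k[g.*2]}}.

Definition point (p : 'I_(g.*2) -> k) : Prop :=
  forall c : 'I_g, ~ (p (crd0 c) = 0 /\ p (crd1 c) = 0).

Definition mhomog (e : 'I_g -> nat) (f : R) : Prop :=
  forall m, m \in msupp f -> forall c : 'I_g, (m (crd0 c) + m (crd1 c))%N = e c.

(* The stalk at p of O(e), as a subset of the fraction field K. *)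
Definition twist_stalk (e : 'I_g -> int) (p : 'I_(g.*2) -> k) (u : K) : Prop :=
  exists (e1 e2 : 'I_g -> nat) (f h : R),
    [/\ mhomog e1 f, mhomog e2 h,
        forall c, (e1 c)%:Z - (e2 c)%:Z = e c,
        h.@[p] != 0 & u = tofrac f / tofrac h].

Definition local_ring := twist_stalk (fun=> 0).

Section Modules.
Variable n : nat.
Implicit Type M : 'rV[R]_n -> Prop.

Definition mhomogv (e : 'I_g -> nat) (v : 'rV[R]_n) : Prop :=
  forall i, mhomog e (v 0 i).

Definition span (G : 'rV[R]_n -> Prop) (v : 'rV[R]_n) : Prop :=
  exists (l : nat) (c : 'I_l -> R) (u : 'I_l -> 'rV[R]_n),
    (forall i, G (u i)) /\ v = \sum_i c i *: u i.

Definition graded_submodule M : Prop :=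
  forall v, M v <-> span (fun u => M u /\ exists e, mhomogv e u) v.

(* The stalk at p of the sheaf associated with M: the degree-zero part of the
   homogeneous localization. *)
Definition stalk M (p : 'I_(g.*2) -> k) (w : 'rV[K]_n) : Prop :=
  exists (e : 'I_g -> nat) (v : 'rV[R]_n) (h : R),
    [/\ M v, mhomogv e v, mhomog e h, h.@[p] != 0
      & w = \row_i (tofrac (v 0 i) / tofrac h)].

Definition sheaf_eq M N : Prop :=
  forall p, point p -> forall w, stalk M p w <-> stalk N p w.

(* The rows of w form a basis of the stalk at p over the local ring. *)
Definition stalk_basis M m (p : 'I_(g.*2) -> k) (w : 'M[K]_(m, n)) : Prop :=
  (forall u, stalk M p u <->
     exists c : 'rV[K]_m, (forall i, local_ring p (c 0 i)) /\ u = c *m w) /\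
  (forall c : 'rV[K]_m, (forall i, local_ring p (c 0 i)) ->
     c *m w = 0 -> c = 0).

(* Every point has a basic open neighbourhood {f <> 0} on which m sections
   trivialize the sheaf. *)
Definition locally_free M m : Prop :=
  forall p, point p ->
    exists (e : 'I_g -> nat) (f : R),
      [/\ mhomog e f, f.@[p] != 0
        & exists w : 'M[K]_(m, n),
            forall p', point p' -> f.@[p'] != 0 -> stalk_basis M p' w].

(* The stalk at p of the image of the m-th exterior power of the sheaf in that
   of O^n, embedded in the m-th tensor power as alternating tensors: the
   coordinates of w_1 /\ ... /\ w_m are its minors, indexed by all maps
   'I_m -> 'I_n.  When the sheaf is locally free of rank m, this image is
   isomorphic to its determinant line bundle. *)
Definition det_stalk M m (p : 'I_(g.*2) -> k)
    (u : {ffun 'I_m -> 'I_n} -> K) : Prop :=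
  exists (l : nat) (c : 'I_l -> K) (w : 'I_l -> 'M[K]_(m, n)),
    [/\ forall j, local_ring p (c j),
        forall j i, stalk M p (row i (w j))
      & forall J, u J = \sum_j c j * \det (colsub J (w j))].

(* The determinant is isomorphic to O(e): an isomorphism from O(e) is
   multiplication by a nonzero vector P of rational functions (necessarily
   homogeneous of degree - e). *)
Definition has_degree M m (e : 'I_g -> int) : Prop :=
  exists P : {ffun 'I_m -> 'I_n} -> K,
    (exists J, P J != 0) /\
    forall p, point p -> forall u,
      det_stalk M p u <->
      exists c, twist_stalk e p c /\ forall J, u J = c * P J.

End Modules.
End Sheaves.

(** * Families over P^1_[s,t] and the torus T *)

Section Families.
Variables (k : fieldType) (n : nat).

Local Notation R := {mpoly k[2.*2]}.
Local Notation K := {fraction {mpoly k[2.*2]}}.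
Implicit Type M : 'rV[R]_n -> Prop.

Definition varx : R := 'X_(crd0 ord0).
Definition vary : R := 'X_(crd1 ord0).
Definition vars : R := 'X_(crd0 ord_max).
Definition vart : R := 'X_(crd1 ord_max).

Definition specialize (s0 t0 : k) (f : R) : {mpoly k[1.*2]} :=
  f \mPo [tuple of [:: 'X_(crd0 ord0); 'X_(crd1 ord0); s0%:MP; t0%:MP]].

(* The fibre over [s0,t0], i.e. the image of M restricted to P^1 x [s0,t0] in
   O^n; flatness of the quotient makes this the restriction itself. *)
Definition fibre (s0 t0 : k) M (v : 'rV[{mpoly k[1.*2]}]_n) : Prop :=
  exists u, M u /\ v = map_mx (specialize s0 t0) u.
Arguments fibre : clear implicits.

(* The local ring of P^1_[s,t] at the image of p, inside the local ring at p. *)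
Definition base_local_ring (p : 'I_(2.*2) -> k) (u : K) : Prop :=
  exists (e : 'I_2 -> nat) (f h : R),
    [/\ e ord0 = 0%N, mhomog e f, mhomog e h, h.@[p] != 0
      & u = tofrac f / tofrac h].

(* O^n / M is flat over P^1_[s,t].  Flatness of its stalks is expressed by the
   equational criterion: every linear relation with coefficients in the base is
   a consequence of relations in the base.  Elements of the quotient are
   represented by vectors over the local ring, modulo the stalk of M. *)
Definition flat_quotient M : Prop :=
  forall p, point p ->
  forall (l : nat) (a : 'I_l -> K) (v : 'I_l -> 'rV[K]_n),
    (forall i, base_local_ring p (a i)) ->
    (forall i j, local_ring p (v i 0 j)) ->
    stalk M p (\sum_i a i *: v i) ->
    exists (l' : nat) (b : 'I_l -> 'I_l' -> K) (w : 'I_l' -> 'rV[K]_n),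
      [/\ forall i j, base_local_ring p (b i j),
          forall j i, local_ring p (w j 0 i),
          forall i, stalk M p (v i - \sum_j b i j *: w j)
        & forall j, \sum_i a i * b i j = 0].

(* (z, q) is an element of T, acting by e_i |-> z_i e_i, x |-> q x, y |-> y;
   s and t are scaled by cs and ct. *)
Definition torus_act (z : 'I_n -> k) (q cs ct : k) (v : 'rV[R]_n) : 'rV[R]_n :=
  \row_i (z i *: (v 0 i \mPo
    [tuple of [:: q *: varx; vary; cs *: vars; ct *: vart]])).

Definition torus_char (al : 'I_n -> int) (al0 : int)
    (z : 'I_n -> k) (q : k) : k :=
  (\prod_i z i ^ al i) * q ^ al0.

Definition T_invariant M : Prop :=
  exists (al be : 'I_n -> int) (al0 be0 : int),
  forall (z : 'I_n -> k) (q : k), (forall i, z i != 0) -> q != 0 ->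
    sheaf_eq
      (fun v => exists2 u, M u &
         v = torus_act z q (torus_char al al0 z q) (torus_char be be0 z q) u)
      M.

(* A T-invariant curve on the quot scheme of quotients of O^n of rank r and
   degree d. *)
Definition T_invariant_curve (d r : nat) M : Prop :=
  [/\ graded_submodule M,
      flat_quotient M,
      forall s0 t0 : k, ~ (s0 = 0 /\ t0 = 0) ->
        locally_free (fibre s0 t0 M) (n - r) /\
        has_degree (fibre s0 t0 M) (n - r) (fun=> - d%:Z)
    & T_invariant M].

End Families.

(** * T-fixed points and the sheaves of types I, II, III *)

Record triple (n : nat) := Triple {
  tdelta : {ffun 'I_n -> bool};
  ta : {ffun 'I_n -> nat};
  tb : {ffun 'I_n -> nat}
}.

Definition fixed_index (d r n : nat) (phi : triple n) : Prop :=
  [/\ (\sum_i tdelta phi i)%N = (n - r)%N,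
      (\sum_i (ta phi i + tb phi i))%N = d
    & forall i, tdelta phi i = false -> ta phi i = 0%N /\ tb phi i = 0%N].

Section Curves.
Variables (k : fieldType) (n : nat).

Definition xymon (g a b : nat) : {mpoly k[g.+1.*2]} :=
  'X_(crd0 ord0) ^+ a * 'X_(crd1 ord0) ^+ b.

(* The generators of S_(delta,a,b) (pulled back from P^1 if g = 1) lying in the
   components i such that P i. *)
Definition fixed_gens (g : nat) (phi : triple n) (P : pred 'I_n)
    (v : 'rV[{mpoly k[g.+1.*2]}]_n) : Prop :=
  exists i, [/\ P i, tdelta phi i
              & v = xymon g (ta phi i) (tb phi i) *: delta_mx 0 i].
Arguments fixed_gens : clear implicits.

Definition fixed_sheaf (phi : triple n) : 'rV[{mpoly k[1.*2]}]_n -> Prop :=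
  span (fixed_gens 0 phi predT).

(* typeIIx and typeIIy are type II of the first and of the second kind. *)
Inductive curve_type :=
  | typeI of 'I_n & 'I_n
  | typeIIx of 'I_n & 'I_n
  | typeIIy of 'I_n & 'I_n
  | typeIII of 'I_n.

(* A sheaf of type II is the pullback of a fixed one where x and y are nonzero,
   hence trivial along P^1_[s,t] there: its degree is (- d, 0), while it is
   (- d, - 1) for types I and III. *)
Definition is_typeII (ty : curve_type) : bool :=
  match ty with typeIIx _ _ | typeIIy _ _ => true | _ => false end.

Definition touched (ty : curve_type) : pred 'I_n :=
  match ty with
  | typeI i j | typeIIx i j | typeIIy i j => pred2 i j
  | typeIII i => pred1 i
  end.

Definition has_type (phi phi' : triple n) (ty : curve_type) : Prop :=
  (forall l, ~~ touched ty l ->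
     [/\ tdelta phi l = tdelta phi' l, ta phi l = ta phi' l
       & tb phi l = tb phi' l]) /\
  match ty with
  | typeI i j =>
      [/\ tdelta phi i, tdelta phi' j, ~~ tdelta phi j & ~~ tdelta phi' i]
  | typeIIx i j =>
      [/\ tdelta phi = tdelta phi', tb phi = tb phi', i != j
        & (ta phi i < ta phi' i)%N]
  | typeIIy i j =>
      [/\ tdelta phi = tdelta phi', ta phi = ta phi', i != j
        & (tb phi i < tb phi' i)%N]
  | typeIII i => tdelta phi = tdelta phi'
  end.

Local Notation e_ i := (delta_mx 0 i : 'rV[{mpoly k[2.*2]}]_n).
Local Notation s := (@vars k).
Local Notation t := (@vart k).
Local Notation mon := (xymon 1).

(* Generators of the component in the touched positions.  For type II, gamma
   is Posz u (u >= 0) or Negz u (= - u.+1 < 0); the subtractions by c are not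
   truncated, as c = a_j - a'_j, respectively b_j - b'_j. *)
Definition component_gens (phi phi' : triple n) (ty : curve_type)
    (v : 'rV[{mpoly k[2.*2]}]_n) : Prop :=
  let a := ta phi in let b := tb phi in
  let a' := ta phi' in let b' := tb phi' in
  match ty with
  | typeI i j =>
      v = (s * mon (a i) (b i)) *: e_ i + (t * mon (a' j) (b' j)) *: e_ j
  | typeIIx i j =>
      let c := (a' i - a i)%N in
      let gamma := (a i + b i + c)%N%:Z - (a j + b j)%N%:Z in
      [\/ v = mon (a i + c) (b i) *: e_ i,
          v = mon (a j) (b j) *: e_ j
        | v = match gamma with
              | Posz u => (s * mon (a i) (b i)) *: e_ i
                          + (t * mon (a j - c) (b j + u)) *: e_ j
              | Negz u => (s * mon (a i) (b i + u.+1)) *: e_ i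
                          + (t * mon (a j - c) (b j)) *: e_ j
              end]
  | typeIIy i j =>
      let c := (b' i - b i)%N in
      let gamma := (a i + b i + c)%N%:Z - (a j + b j)%N%:Z in
      [\/ v = mon (a i) (b i + c) *: e_ i,
          v = mon (a j) (b j) *: e_ j
        | v = match gamma with
              | Posz u => (s * mon (a i) (b i)) *: e_ i
                          + (t * mon (a j + u) (b j - c)) *: e_ j
              | Negz u => (s * mon (a i + u.+1) (b i)) *: e_ i
                          + (t * mon (a j) (b j - c)) *: e_ j
              end]
  | typeIII i =>
      v = (s * mon (a i) (b i) + t * mon (a' i) (b' i)) *: e_ i
  end.

Definition curve_sheaf (phi phi' : triple n) (ty : curve_type) :
    'rV[{mpoly k[2.*2]}]_n -> Prop :=
  span (fun v => component_gens phi phi' ty v \/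
                 fixed_gens 1 phi (predC (touched ty)) v).

End Curves.

Arguments fixed_sheaf : clear implicits.
Arguments curve_sheaf : clear implicits.
Arguments fibre {k n} s0 t0 M v.

(* Main.v *)
From HB Require Import structures.
From mathcomp Require Import all_boot all_order all_algebra.
From mathcomp Require Import fraction mpoly.
From mathcomp Require Import ring zify.
Require Import Defs.

(** A sheaf on (P^1)^g is described by local frames with prescribed minors
    ([frame], [framed]): near each point, as many sections as the rank generate
    it, and their maximal minors are a fixed nonzero vector [P] of polynomials,
    up to a form that does not vanish near the point.  A sheaf with frames is
    locally free, and its determinant is the line bundle with generator [P], so
    that the degree can be read off from the degrees of the frame
    ([framed_locally_free], [framed_has_degree]).

    Frames on P^1 x P^1 restrict to the fibres over [s0,t0]: generators, frames
    and [P] are specialized at [s,t] = [s0,t0] ([framed_fibre]).  If [P] does not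
    vanish identically on any fibre, then every fibre is locally free of the
    expected degree, and O^n / S is flat over P^1_[s,t] ([framed_flat]): the local
    ring of the base is a discrete valuation ring, and a section of O^n which
    becomes a section of S after multiplication by a local parameter already is
    one, because its coordinates in the frame are obtained by Cramer's rule from
    a minor that the local parameter does not divide.  So the whole statement
    reduces to frames, to the fibres over [1,0] and [0,1], and to the weights of
    the torus on the generators ([framed_claims]).

    In types I and III the sheaf is free on its generators, which form one frame
    valid everywhere.  The minors involving s x^a_i y^b_i or t x^a'_j y^b'_j are
    nonzero on the fibres with s0 or t0 nonzero ([joint_claims]).

    In type II the three generators g1, g2, g3 satisfy, in the first kind,
      x^c g3 = s y^u g1 + t y^v g2,
    where u and v are nonnegative, v - u = gamma and one of them is 0; exchange x
    and y for the second kind.  The three coefficients have no common zero on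
    P^1 x P^1, and where one of them is nonzero the other two generators form a
    frame.  The minors of this frame are those of the fixed point, which involve
    x and y only, times that coefficient ([pencil_framed], [pencil_claims]).  Hence
    the determinant has degree 0 in [s,t].  Over [1,0], the generators in position i are the
    multiples by x^c and y^u of the generator of the fixed point; they span the
    same sheaf, though not the same module when u > 0 ([pencil_fibre]).

    In each type the torus scales both terms of the mixed generator equally once
    s has the weight of the term in t, and t that of the term in s
    ([joint_gen_torus]). *)

Set Implicit Arguments.
Unset Strict Implicit.
Unset Printing Implicit Defensive.
Import GRing.Theory.
Local Open Scope ring_scope.

(** * Multihomogeneous polynomials *)

Section Homogeneous.
Variables (k : fieldType) (g : nat).
Local Notation R := {mpoly k[g.*2]}.
Implicit Types (f h : R) (e d : 'I_g -> nat) (m : 'X_{1..g.*2}).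

Definition has_mdeg e m :=
  [forall c : 'I_g, (m (crd0 c) + m (crd1 c))%N == e c].

Lemma mhomogP e f :
  mhomog e f <-> (forall m, f@_m != 0 -> has_mdeg e m).
Proof.
split=> H m.
  by rewrite -mcoeff_msupp => /H He; apply/forallP=> c; apply/eqP.
by rewrite mcoeff_msupp => /H /forallP He c; apply/eqP.
Qed.

Lemma eq_mhomog d e f : d =1 e -> mhomog d f -> mhomog e f.
Proof. by move=> de Hf m /Hf Hm c; rewrite -de. Qed.

Lemma mhomog0 e : mhomog e (0 : R).
Proof. by move=> m; rewrite msupp0. Qed.

Lemma mhomogC (a : k) : mhomog (fun=> 0%N) (a%:MP : R).
Proof.
move=> m; rewrite msuppC; case: eqP => // _; rewrite inE => /eqP -> c.
by rewrite !mnm0E.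
Qed.

Lemma mhomog1 : mhomog (fun=> 0%N) (1 : R).
Proof. by rewrite -mpolyC1; apply: mhomogC. Qed.

Lemma mhomogD e f h : mhomog e f -> mhomog e h -> mhomog e (f + h).
Proof. by move=> Hf Hh m /msuppD_le; rewrite mem_cat => /orP[/Hf|/Hh]. Qed.

Lemma mhomogN e f : mhomog e f -> mhomog e (- f).
Proof. by move=> Hf m; rewrite (perm_mem (msuppN f)) => /Hf. Qed.

Lemma mhomogZ e (a : k) f : mhomog e f -> mhomog e (a *: f).
Proof. by move=> Hf m /msuppZ_le /Hf. Qed.

Lemma mhomogM d e f h :
  mhomog d f -> mhomog e h -> mhomog (fun c => d c + e c)%N (f * h).
Proof.
move=> Hf Hh m /msuppM_le /allpairsP[[m1 m2] /= [/Hf H1 /Hh H2 ->]] c.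
by rewrite !mnmDE -H1 -H2 addnACA.
Qed.

Lemma mhomogXn e f j : mhomog e f -> mhomog (fun c => j * e c)%N (f ^+ j).
Proof.
move=> Hf; elim: j => [|j IHj].
  by rewrite expr0; apply: eq_mhomog mhomog1 => c; rewrite mul0n.
by rewrite exprS; apply: eq_mhomog (mhomogM Hf IHj) => c; rewrite mulSn.
Qed.

Lemma mhomog_prod (I : Type) (r : seq I) (F : I -> R) (E : I -> 'I_g -> nat) :
  (forall i, mhomog (E i) (F i)) ->
  mhomog (fun c => \sum_(i <- r) E i c)%N (\prod_(i <- r) F i).
Proof.
move=> H; elim: r => [|i r IHr].
  by rewrite big_nil; apply: eq_mhomog mhomog1 => c; rewrite big_nil.
by rewrite big_cons; apply: eq_mhomog (mhomogM (H i) IHr) => c; rewrite big_cons.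
Qed.

Lemma mhomog_crd0 (c : 'I_g) :
  mhomog (fun c' => (c == c') : nat) ('X_(crd0 c) : R).
Proof.
move=> m; rewrite msuppX inE => /eqP -> c'; rewrite !mnm1E -!val_eqE /=.
by case: (c =P c') => [->|/val_eqP/eqP /= cc']; lia.
Qed.

Lemma mhomog_crd1 (c : 'I_g) :
  mhomog (fun c' => (c == c') : nat) ('X_(crd1 c) : R).
Proof.
move=> m; rewrite msuppX inE => /eqP -> c'; rewrite !mnm1E -!val_eqE /=.
by case: (c =P c') => [->|/val_eqP/eqP /= cc']; lia.
Qed.

Definition hcomp e f : R := \sum_(m <- msupp f | has_mdeg e m) f@_m *: 'X_[m].

Lemma mcoeff_hcomp e f m : (hcomp e f)@_m = if has_mdeg e m then f@_m else 0.
Proof.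
rewrite /hcomp raddf_sum /= [in RHS](mpolyE f) raddf_sum /= big_mkcond /=.
case: ifPn => Hm.
  apply: eq_bigr => m' _; rewrite mcoeffZ mcoeffX.
  by case: eqP => [->|_]; rewrite ?Hm ?mulr0 ?if_same.
rewrite big1 // => m' _; rewrite mcoeffZ mcoeffX.
by case: eqP => [->|_]; rewrite ?(negPf Hm) ?mulr0 ?if_same.
Qed.

Lemma hcomp_mhomog e f : mhomog e (hcomp e f).
Proof. by apply/mhomogP=> m; rewrite mcoeff_hcomp; case: ifP => // _ /eqP. Qed.

Lemma hcomp_id e f : mhomog e f -> hcomp e f = f.
Proof.
move=> /mhomogP Hf; apply/mpolyP=> m; rewrite mcoeff_hcomp.
by case: ifPn => // Hm; apply/esym/eqP/negPn/negP => /Hf; rewrite (negPf Hm).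
Qed.

Lemma hcomp_is_zmod_morphism e : zmod_morphism (hcomp e).
Proof.
move=> f h; apply/mpolyP=> m.
by rewrite mcoeffB !mcoeff_hcomp mcoeffB; case: ifP => //; rewrite subr0.
Qed.
HB.instance Definition _ e :=
  GRing.isZmodMorphism.Build R R (hcomp e) (hcomp_is_zmod_morphism e).

Lemma hcompZ e a f : hcomp e (a *: f) = a *: hcomp e f.
Proof.
apply/mpolyP=> m; rewrite mcoeffZ !mcoeff_hcomp mcoeffZ.
by case: ifP => //; rewrite mulr0.
Qed.

(** The cofactor of [h] in the component of degree [e] of [f * h], for [h]
    homogeneous of degree [d].  When [d <= e] fails, that component is 0, whereas
    the truncated subtraction would select an unrelated component of [f]. *)
Definition hcoef e d f : R :=
  if [forall c, d c <= e c]%N then hcomp (fun c => e c - d c)%N f else 0.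

(** Coefficients of a linear combination may be made homogeneous: taking the
    component of degree [e] of [\sum_i c_i * h_i], with the [h_i] homogeneous,
    replaces each [c_i] by a homogeneous polynomial.  Elements of a span come
    with arbitrary coefficients, and this turns them into sections of line
    bundles. *)
Lemma hcompM e d f h : mhomog d h -> hcomp e (f * h) = hcoef e d f * h.
Proof.
move=> Hh.
rewrite {1}(mpolyE f) mulr_suml raddf_sum /=.
have -> : hcoef e d f =
    \sum_(m <- msupp f) f@_m *: hcoef e d 'X_[m].
  rewrite /hcoef; case: ifP => _; last by rewrite big1 // => m _; rewrite scaler0.
  by rewrite {1}(mpolyE f) raddf_sum /=; apply: eq_bigr => m _; rewrite hcompZ.
rewrite mulr_suml; apply: eq_bigr => m _.
rewrite -scalerAl hcompZ -scalerAl; congr (_ *: _).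
apply/mpolyP=> q; rewrite mcoeff_hcomp.
pose dm c := (m (crd0 c) + m (crd1 c))%N.
have Hm : mhomog dm ('X_[m] : R) by move=> q'; rewrite msuppX inE => /eqP ->.
have /mhomogP Hmh := mhomogM Hm Hh.
have [[le_de He]|Hne] : ([forall c, d c <= e c]%N /\ has_mdeg (fun c => e c - d c)%N m)
   \/ ~~ ([forall c, d c <= e c]%N && has_mdeg (fun c => e c - d c)%N m).
- by case: (boolP ([forall c, d c <= e c]%N && _)) => [/andP|]; [left|right].
- rewrite /hcoef le_de hcomp_id; last first.
    by move=> q'; rewrite msuppX inE => /eqP -> c; apply/eqP; move/forallP: He.
  case: ifPn => // Hq; apply/esym/eqP/negPn/negP => /Hmh /forallP Hq'.
  case/negP: Hq; apply/forallP => c; move/forallP: He => /(_ c) /eqP.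
  move/forallP: le_de => /(_ c); have /eqP := Hq' c; rewrite /dm => -> ? ->.
  by rewrite subnK.
have -> : hcoef e d 'X_[m] = 0.
  rewrite /hcoef; case: ifP Hne => //= _ Hne; apply/mpolyP => q'.
  rewrite mcoeff_hcomp mcoeff0 mcoeffX; case: eqP => [<-|]; last by rewrite if_same.
  by rewrite (negPf Hne).
rewrite mul0r mcoeff0; case: ifPn => // /forallP Hq.
apply/eqP/negPn/negP => /Hmh /forallP Hq'; case/negP: Hne.
apply/andP; split; apply/forallP => c; move: (Hq c) (Hq' c) => /eqP <- /eqP ->.
  by rewrite leq_addl.
by rewrite addnK.
Qed.

Lemma hcoef_mulhomog e d f h : mhomog d h -> mhomog e (hcoef e d f * h).
Proof. by move=> Hh; rewrite -hcompM //; apply: hcomp_mhomog. Qed.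

End Homogeneous.
Arguments mhomog1 {k g}.
Arguments mhomog0 {k g} e.
Arguments mhomog_prod {k g I} r {F E} _.
Arguments mhomogXn {k g e f} j _.
Arguments mhomog_crd0 {k g} c.
Arguments mhomog_crd1 {k g} c.
Arguments eq_mhomog {k g d e f} _ _.
Arguments mhomogM {k g d e f h} _ _.
Arguments mhomogD {k g e f h} _ _.
Arguments mhomogN {k g e f} _.
Arguments mhomogZ {k g e} a {f} _.
Arguments hcomp_mhomog {k g} e f.
Arguments hcoef_mulhomog {k g} e {d} f {h} _.

(** * Identities between fractions *)

Section FieldIdentities.
Variable F : fieldType.
Implicit Types b c f h u w y : F.

Lemma frac_rescale b w h f (z : F) : f != 0 -> z != 0 ->
  b * w / h = f * (b * z / (f * h) * (w / z)).
Proof.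
move=> f0 z0; rewrite invfM -[LHS]mul1r -[X in X * _](divff f0).
by rewrite -[LHS]mul1r -[X in X * _](divff z0); ring.
Qed.

Lemma frac_cancel c f h w : f != 0 -> h != 0 ->
  c * w = c * (h / f) * (f / h * w).
Proof. by move=> f0 h0; field; rewrite f0 h0. Qed.

Lemma frac_cross y a b l L c d1 d2 (b' : F) : b != 0 -> L != 0 -> d2 != 0 -> b' != 0 ->
  y = a / b * (l / L) -> y * (d1 / d2) = c / b' ->
  a * l * d1 * b' = c * d2 * b * L.
Proof.
move=> b0 L0 d20 b'0 -> E.
have -> : a * l * d1 * b' = a / b * (l / L) * (d1 / d2) * (d2 * b * L * b').
  by field; rewrite d20 b0 L0.
by rewrite E; field.
Qed.

Lemma frac_valuation L l c h j : l != 0 ->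
  L ^+ j * c / h = (L / l) ^+ j * (l ^+ j * c / h).
Proof. by move=> l0; rewrite expr_div_n !mulrA divfK // expf_neq0. Qed.

Lemma frac_solve y u (l L : F) : L != 0 -> l != 0 -> y * (L / l) = u -> y = u * (l / L).
Proof. by move=> L0 l0 <-; field; rewrite L0 l0. Qed.

Lemma frac_exchange c b l L : L != 0 -> c * L / b * (l / L) = c * l / b.
Proof. by move=> L0; rewrite -[RHS]mulr1 -[X in _ = _ * X](divff L0); ring. Qed.

Lemma frac_power_quotient u y b i j : b != 0 -> (j <= i)%N ->
  u ^+ i * y = u ^+ (i - j) * (y * b^-1) * (u ^+ j * b).
Proof.
move=> b0 ji; rewrite -{1}(subnK ji) exprD.
by rewrite -[LHS]mulr1 -[X in _ * X = _](divff b0); ring.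
Qed.

End FieldIdentities.

(** * Local rings and twisting sheaves *)

Section LocalRing.
Variables (k : fieldType) (g : nat).
Local Notation R := {mpoly k[g.*2]}.
Local Notation K := {fraction {mpoly k[g.*2]}}.
Implicit Types (f h : R) (e d : 'I_g -> nat) (p : 'I_(g.*2) -> k) (u v : K).

Lemma tofrac_neq0 f p : f.@[p] != 0 -> tofrac f != 0.
Proof. by rewrite tofrac_eq0; apply: contraNneq => ->; rewrite meval0. Qed.

Lemma eq_twist_stalk (e1 e2 : 'I_g -> int) p u :
  e1 =1 e2 -> twist_stalk e1 p u -> twist_stalk e2 p u.
Proof.
move=> e12 [d1 [d2 [f [h [Hf Hh Hd hp ->]]]]]; exists d1, d2, f, h.
by split=> // c; rewrite -e12.
Qed.

Lemma local_ring_frac e f h p :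
  mhomog e f -> mhomog e h -> h.@[p] != 0 -> local_ring p (tofrac f / tofrac h).
Proof. by move=> Hf Hh hp; exists e, e, f, h; split=> // c; rewrite subrr. Qed.

Lemma local_ringP p u : local_ring p u ->
  exists e f h, [/\ mhomog e f, mhomog e h, h.@[p] != 0
                  & u = tofrac f / tofrac h].
Proof.
move=> [e1 [e2 [f [h [Hf Hh He hp ->]]]]]; exists e1, f, h; split=> //.
by apply: eq_mhomog Hh => c; apply/eqP; rewrite -eqz_nat eq_sym -subr_eq0 He.
Qed.

Lemma twist_stalkM (e1 e2 : 'I_g -> int) p u v :
  twist_stalk e1 p u -> twist_stalk e2 p v ->
  twist_stalk (fun c => e1 c + e2 c) p (u * v).
Proof.
move=> [d1 [d1' [f1 [h1 [Hf1 Hh1 He1 hp1 ->]]]]].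
move=> [d2 [d2' [f2 [h2 [Hf2 Hh2 He2 hp2 ->]]]]].
exists (fun c => d1 c + d2 c)%N, (fun c => d1' c + d2' c)%N, (f1 * f2), (h1 * h2).
split; [exact: mhomogM | exact: mhomogM | | by rewrite mevalM mulf_neq0 |].
  by move=> c; rewrite -He1 -He2 !PoszD; ring.
by rewrite !tofracM invfM mulrACA.
Qed.

Lemma local_ring0 p : local_ring p 0.
Proof.
have := local_ring_frac (mhomog0 _) mhomog1 (p := p).
by rewrite tofrac0 mul0r meval1; apply; apply: oner_neq0.
Qed.

Lemma local_ring1 p : local_ring p 1.
Proof.
have := local_ring_frac mhomog1 mhomog1 (p := p).
by rewrite tofrac1 divr1 meval1; apply; apply: oner_neq0.
Qed.

Lemma local_ringD p u v : local_ring p u -> local_ring p v -> local_ring p (u + v).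
Proof.
move=> /local_ringP[e1 [f1 [h1 [Hf1 Hh1 hp1 ->]]]].
move=> /local_ringP[e2 [f2 [h2 [Hf2 Hh2 hp2 ->]]]].
rewrite (addf_div _ _ (tofrac_neq0 hp1) (tofrac_neq0 hp2)) -!tofracM -tofracD.
apply: (@local_ring_frac (fun c => e1 c + e2 c)%N); last by rewrite mevalM mulf_neq0.
  apply: mhomogD; first exact: mhomogM.
  by apply: eq_mhomog (mhomogM Hf2 Hh1) => c; rewrite addnC.
exact: mhomogM.
Qed.

Lemma local_ringM p u v : local_ring p u -> local_ring p v -> local_ring p (u * v).
Proof.
move=> Hu Hv; apply: eq_twist_stalk (twist_stalkM Hu Hv) => c.
by rewrite addr0.
Qed.

Lemma local_ringN p u : local_ring p u -> local_ring p (- u).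
Proof.
move=> /local_ringP[e [f [h [Hf Hh hp ->]]]]; rewrite -mulNr -tofracN.
by apply: local_ring_frac Hh hp; apply: mhomogN.
Qed.

Lemma local_ring_sum (I : Type) (r : seq I) (P : pred I) (F : I -> K) p :
  (forall i, local_ring p (F i)) -> local_ring p (\sum_(i <- r | P i) F i).
Proof.
move=> H; elim/big_ind: _ => //; first exact: local_ring0.
exact: local_ringD.
Qed.

Lemma local_ring_prod (I : Type) (r : seq I) (P : pred I) (F : I -> K) p :
  (forall i, local_ring p (F i)) -> local_ring p (\prod_(i <- r | P i) F i).
Proof.
move=> H; elim/big_ind: _ => //; first exact: local_ring1.
exact: local_ringM.
Qed.

Lemma local_ring_sign (j : nat) p u : local_ring p u -> local_ring p ((-1) ^+ j * u).
Proof.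
rewrite -signr_odd mulr_sign; case: odd => //; exact: local_ringN.
Qed.

Lemma local_ring_mulmx p m1 m2 m3 (A : 'M[K]_(m1, m2)) (B : 'M[K]_(m2, m3)) :
  (forall i j, local_ring p (A i j)) -> (forall i j, local_ring p (B i j)) ->
  forall i j, local_ring p ((A *m B) i j).
Proof.
by move=> HA HB i j; rewrite mxE; apply: local_ring_sum => l; apply: local_ringM.
Qed.

Lemma local_ring_det p m (A : 'M[K]_m) :
  (forall i j, local_ring p (A i j)) -> local_ring p (\det A).
Proof.
move=> HA; apply: local_ring_sum => s; apply: local_ring_sign.
exact: local_ring_prod.
Qed.

Lemma local_ring_adj p m (A : 'M[K]_m) :
  (forall i j, local_ring p (A i j)) -> forall i j, local_ring p ((\adj A) i j).
Proof.
move=> HA i j; rewrite mxE; apply: local_ring_sign; apply: local_ring_det => i' j'.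
by rewrite !mxE.
Qed.

(** On each factor P^1, one of the two coordinates does not vanish at [p]. *)
Definition chart_coord p (c : 'I_g) : R :=
  if p (crd0 c) != 0 then 'X_(crd0 c) else 'X_(crd1 c).

(** Forms of every degree that do not vanish at [p]; dividing by them
    dehomogenizes.  The coordinates are chosen by [p] alone, so that one choice
    serves for all points near [p]. *)
Definition chart_form p d : R := \prod_c chart_coord p c ^+ d c.

Lemma chart_form_mhomog p d : mhomog d (chart_form p d).
Proof.
have Hc c : mhomog (fun c' => d c * (c == c'))%N (chart_coord p c ^+ d c).
  apply: mhomogXn; rewrite /chart_coord.
  by case: ifP => _; [apply: mhomog_crd0 | apply: mhomog_crd1].
have := mhomog_prod (index_enum _) Hc; apply: eq_mhomog => c /=.
rewrite (bigD1 c) //= eqxx muln1 big1 ?addn0 // => c' /negPf ->.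
by rewrite muln0.
Qed.

Lemma chart_form_eval p p' d :
  (chart_form p (fun=> 1%N)).@[p'] != 0 -> (chart_form p d).@[p'] != 0.
Proof.
rewrite /chart_form !rmorph_prod => /prodf_neq0 H; apply/prodf_neq0 => c.
move=> Hc; rewrite rmorphXn expf_neq0 //.
by have := H c Hc; rewrite expr1.
Qed.

Lemma chart_form_neq0 p d : point p -> (chart_form p d).@[p] != 0.
Proof.
move=> Hp; rewrite /chart_form rmorph_prod; apply/prodf_neq0 => c _.
rewrite rmorphXn expf_neq0 // /chart_coord; case: ifPn => /=.
  by rewrite mevalXU.
move/negPn/eqP => p0; rewrite mevalXU; apply/eqP => p1; exact: (Hp c).
Qed.

End LocalRing.
Arguments chart_form_mhomog {k g} p d.

(** * Spans and their stalks *)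

Section Stalks.
Variables (k : fieldType) (g n : nat).
Local Notation R := {mpoly k[g.*2]}.
Local Notation K := {fraction {mpoly k[g.*2]}}.
Implicit Types (G M N : 'rV[R]_n -> Prop) (p : 'I_(g.*2) -> k) (u v : 'rV[R]_n).

Lemma span_gen G u : G u -> span G u.
Proof.
move=> Gu; exists 1%N, (fun=> 1), (fun=> u); split=> //.
by rewrite big_ord1 scale1r.
Qed.

Lemma span0 G : span G 0.
Proof. by exists 0%N, (fun=> 0), (fun=> 0); split=> [[]|]//; rewrite big_ord0. Qed.

Lemma spanZ G a u : span G u -> span G (a *: u).
Proof.
move=> [l [c [w [Gw ->]]]]; exists l, (fun i => a * c i), w; split=> //.
by rewrite scaler_sumr; apply: eq_bigr => i _; rewrite scalerA.
Qed.

Lemma spanD G u v : span G u -> span G v -> span G (u + v).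
Proof.
move=> [l1 [c1 [w1 [Gw1 ->]]]] [l2 [c2 [w2 [Gw2 ->]]]].
exists (l1 + l2)%N, (fun i => match split i with inl j => c1 j | inr j => c2 j end),
  (fun i => match split i with inl j => w1 j | inr j => w2 j end).
split=> [i|]; first by case: split.
rewrite big_split_ord /=; congr (_ + _); apply: eq_bigr => i _.
  by rewrite (unsplitK (inl _ i)).
by rewrite (unsplitK (inr _ i)).
Qed.

Lemma span_ind G (Q : 'rV[R]_n -> Prop) :
  Q 0 -> (forall u v, Q u -> Q v -> Q (u + v)) ->
  (forall a u, G u -> Q (a *: u)) -> forall u, span G u -> Q u.
Proof.
move=> Q0 QD QZ u [l [c [w [Gw ->]]]].
by elim/big_ind: _ => // i _; apply: QZ.
Qed.

Lemma span_sub G (H : 'rV[R]_n -> Prop) :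
  (forall u, G u -> span H u) -> forall u, span G u -> span H u.
Proof.
move=> GH; apply: span_ind => [|u v|a u /GH]; [exact: span0|exact: spanD|].
exact: spanZ.
Qed.

Lemma span_graded G :
  (forall u, G u -> exists e, mhomogv e u) -> graded_submodule (span G).
Proof.
move=> HG v; split.
  by apply: span_sub => u Gu; apply: span_gen; split; [apply: span_gen|apply: HG].
by apply: span_ind => [|u w|a u [Gu _]]; [exact: span0|exact: spanD|exact: spanZ].
Qed.

Lemma eq_sheaf M N : (forall u, M u <-> N u) -> sheaf_eq M N.
Proof.
by move=> H p _ w; split=> -[e [v [h [Mv Hv Hh hp ->]]]];
  exists e, v, h; split=> //; apply/H.
Qed.

Lemma stalk0 G p : stalk (span G) p 0.
Proof.
exists (fun=> 0%N), 0, 1; split; [exact: span0| |exact: mhomog1| |].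
- by move=> i; rewrite mxE; apply: mhomog0.
- by rewrite meval1 oner_neq0.
- by apply/rowP=> i; rewrite !mxE tofrac0 mul0r.
Qed.

Lemma stalkD G p w1 w2 :
  stalk (span G) p w1 -> stalk (span G) p w2 -> stalk (span G) p (w1 + w2).
Proof.
move=> [e1 [v1 [h1 [G1 Hv1 Hh1 hp1 ->]]]] [e2 [v2 [h2 [G2 Hv2 Hh2 hp2 ->]]]].
exists (fun c => e1 c + e2 c)%N, (h2 *: v1 + h1 *: v2), (h1 * h2); split.
- by apply: spanD; apply: spanZ.
- move=> i; rewrite !mxE; apply: mhomogD; last exact: mhomogM.
  by rewrite mulrC; apply: mhomogM.
- exact: mhomogM.
- by rewrite mevalM mulf_neq0.
- apply/rowP=> i; rewrite !mxE (addf_div _ _ (tofrac_neq0 hp1) (tofrac_neq0 hp2)).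
  by rewrite -!tofracM -tofracD; congr (tofrac _ / _); ring.
Qed.

Lemma stalkZ G p a w :
  local_ring p a -> stalk (span G) p w -> stalk (span G) p (a *: w).
Proof.
move=> /local_ringP[e1 [f1 [h1 [Hf1 Hh1 hp1 ->]]]] [e2 [v2 [h2 [G2 Hv2 Hh2 hp2 ->]]]].
exists (fun c => e1 c + e2 c)%N, (f1 *: v2), (h1 * h2); split.
- exact: spanZ.
- by move=> i; rewrite mxE; apply: mhomogM.
- exact: mhomogM.
- by rewrite mevalM mulf_neq0.
- by apply/rowP=> i; rewrite !mxE !tofracM invfM mulrACA.
Qed.

Lemma stalk_mulmx G p m (c : 'rV[K]_m) (w : 'M[K]_(m, n)) :
  (forall i, local_ring p (c 0 i)) -> (forall i, stalk (span G) p (row i w)) ->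
  stalk (span G) p (c *m w).
Proof.
move=> Hc Hw; rewrite mulmx_sum_row; elim/big_ind: _ => [|u v|i _].
- exact: stalk0.
- exact: stalkD.
- exact: stalkZ (Hc i) (Hw i).
Qed.

(** A form that is nonzero at [p] is invertible in the stalk at [p]; so a
    generator of the larger module may be multiplied by such a form in order to
    land in the smaller one. *)
Lemma sheaf_eq_span G (H : 'rV[R]_n -> Prop) :
  (forall u, G u -> span H u) ->
  (forall p, point p -> exists e f, [/\ mhomog e f, f.@[p] != 0
     & forall u, H u -> span G (f *: u)]) ->
  sheaf_eq (span G) (span H).
Proof.
move=> GH HG p Hp w; split=> -[e [v [h [Mv Hv Hh hp ->]]]].
  by exists e, v, h; split=> //; apply: span_sub Mv.
have [e' [f [Hf fp fG]]] := HG p Hp.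
exists (fun c => e' c + e c)%N, (f *: v), (f * h); split.
- move: Mv; elim/span_ind => [|u1 u2|a u Hu].
  + by rewrite scaler0; apply: span0.
  + by rewrite scalerDr; apply: spanD.
  + by rewrite scalerA mulrC -scalerA; apply: spanZ; apply: fG.
- by move=> i; rewrite mxE; apply: mhomogM.
- exact: mhomogM.
- by rewrite mevalM mulf_neq0.
- apply/rowP=> i; rewrite !mxE !tofracM invfM mulrACA divff ?mul1r //.
  exact: tofrac_neq0 fp.
Qed.

Lemma eq_locally_free M N m : sheaf_eq M N -> locally_free M m -> locally_free N m.
Proof.
move=> MN HM p Hp; have [e [f [Hf fp [w Hw]]]] := HM p Hp.
exists e, f; split=> //; exists w => p' Hp' fp'.
have [H1 H2] := Hw p' Hp' fp'; split=> // u.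
by apply: iff_trans (H1 u); apply: iff_sym; apply: MN.
Qed.

Lemma eq_has_degree M N m e : sheaf_eq M N -> has_degree M m e -> has_degree N m e.
Proof.
move=> MN [P [HP H]]; exists P; split=> // p Hp u.
apply: iff_trans (H p Hp u); split=> -[l [c [w [Hc Hw Hu]]]];
  by exists l, c, w; split=> // j i; apply/(MN p Hp).
Qed.

(** If the rows of a matrix are combinations of the basis [w], with coefficient
    matrix [A], its minors are those of [w] times [\det A]. *)
Lemma det_stalk_basis G m p (w : 'M[K]_(m, n)) (u : {ffun 'I_m -> 'I_n} -> K) :
  stalk_basis (span G) p w ->
  det_stalk (span G) p u <->
  exists c, local_ring p c /\ forall J, u J = c * \det (colsub J w).
Proof.
move=> [Hw _]; split=> [[l [c [v [Hc Hv Hu]]]]|[c [Hc Hu]]].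
  pose L (A : 'M[K]_m) := forall i j, local_ring p (A i j).
  have : forall j, exists A, L A /\ v j = A *m w.
    move=> j.
    have : forall i, exists a : 'rV[K]_m,
        (forall i', local_ring p (a 0 i')) /\ row i (v j) = a *m w.
      by move=> i; apply/Hw/Hv.
    case/(fin_all_exists (P := fun i a => _)) => a Ha.
    exists (\matrix_i a i); split=> [i i'|].
      by rewrite mxE; case: (Ha i).
    by apply/row_matrixP => i; rewrite row_mul rowK; case: (Ha i).
  case/(fin_all_exists (P := fun j A => _)) => A HA.
  exists (\sum_j c j * \det (A j)); split.
    apply: local_ring_sum => j; apply: local_ringM => //.
    by apply: local_ring_det; case: (HA j).
  move=> J; rewrite Hu mulr_suml; apply: eq_bigr => j _.
  by case: (HA j) => _ ->; rewrite -mulmx_colsub det_mulmx mulrA.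
exists 1%N, (fun=> c), (fun=> w); split=> // [_ i|J]; last by rewrite big_ord1.
apply/Hw; exists (delta_mx 0 i); split; last by rewrite -rowE.
by move=> i'; rewrite mxE; case: (_ && _); [apply: local_ring1|apply: local_ring0].
Qed.

End Stalks.

(** * Frames: local bases with prescribed minors *)

Section Frames.
Variables (k : fieldType) (g n : nat).
Local Notation R := {mpoly k[g.*2]}.
Local Notation K := {fraction {mpoly k[g.*2]}}.
Variables (G : 'rV[R]_n -> Prop) (m : nat) (e : 'I_g -> int).
Variable P : {ffun 'I_m -> 'I_n} -> R.

(** Where the form [f] does not vanish, the rows of [W] are a basis of the sheaf
    spanned by [G]: [f] clears the denominators of the generators.  The vector
    [P] does not depend on the chart, and the same [f] compares it with the
    minors of [W]; this is Cramer's rule in the examples below.  The integers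
    [df - \sum_i d i], which must be the same on all charts, are then the degree
    of the determinant. *)
Record frame (f : R) (W : 'M[R]_(m, n)) (df : 'I_g -> nat)
    (d : 'I_m -> 'I_g -> nat) : Prop := Frame {
  frame_hom : mhomog df f;
  frame_row : forall i, mhomogv (d i) (row i W);
  frame_deg : forall c, (df c)%:Z - \sum_i (d i c)%:Z = e c;
  frame_span : forall i, span G (row i W);
  frame_gen : forall u, G u -> exists c : 'rV[R]_m, f *: u = c *m W;
  frame_minor : forall J : {ffun 'I_m -> 'I_n}, \det (colsub J W) = f * P J
}.

Definition framed : Prop :=
  forall p, point p -> exists f W df d, f.@[p] != 0 /\ frame f W df d.

Definition local_rows (p : 'I_(g.*2) -> k) (W : 'M[R]_(m, n))
    (d : 'I_m -> 'I_g -> nat) : 'M[K]_(m, n) :=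
  \matrix_(i, j) (tofrac (W i j) / tofrac (chart_form p (d i))).

Section OneFrame.
Variables (f : R) (W : 'M[R]_(m, n)) (df : 'I_g -> nat) (d : 'I_m -> 'I_g -> nat).
Hypothesis frameW : frame f W df d.

Lemma frame_entry i j : mhomog (d i) (W i j).
Proof. by have := @frame_row _ _ _ _ frameW i j; rewrite mxE. Qed.

Lemma frame_vector v : span G v -> exists c : 'rV[R]_m, f *: v = c *m W.
Proof.
elim/span_ind => [|u1 u2 [c1 H1] [c2 H2]|a u /(frame_gen frameW) [c Hc]].
- by exists 0; rewrite scaler0 mul0mx.
- by exists (c1 + c2); rewrite scalerDr H1 H2 mulmxDl.
- by exists (a *: c); rewrite scalerA mulrC -scalerA Hc scalemxAl.
Qed.

Lemma det_local_rows p (J : {ffun 'I_m -> 'I_n}) :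
  \det (colsub J (local_rows p W d)) =
  tofrac f / (\prod_i tofrac (chart_form p (d i))) * tofrac (P J).
Proof.
have -> : local_rows p W d =
    diag_mx (\row_i (tofrac (chart_form p (d i)))^-1) *m map_mx (@tofrac _) W.
  by apply/matrixP=> i j; rewrite mul_diag_mx !mxE mulrC.
rewrite -mulmx_colsub det_mulmx det_diag -map_mxsub det_map_mx (frame_minor frameW).
rewrite rmorphM /= mulrA; congr (_ * _); rewrite mulrC.
by congr (_ * _); rewrite -prodfV; apply: eq_bigr => i _; rewrite mxE.
Qed.

(** Independence holds since some minor of [W] is nonzero.  For generation, write
    [f *: v] as a combination of the rows of [W], make the coefficients
    homogeneous and divide by forms that are nonzero at [p']. *)
Lemma frame_basis p p' :
    (exists J, P J != 0) -> f.@[p'] != 0 ->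
    (chart_form p (fun=> 1%N)).@[p'] != 0 ->
  stalk_basis (span G) p' (local_rows p W d).
Proof.
move=> [J PJ] fp' cp'.
have hp' i : (chart_form p (d i)).@[p'] != 0 by apply: chart_form_eval.
split=> [u|c _ cw0].
  split=> [[eu [v [h [Gv Hv Hh hp ->]]]]|[c [Hc ->]]].
    have [c Hc] := frame_vector Gv.
    pose b i := hcoef (fun c => df c + eu c)%N (d i) (c 0 i).
    have Hb j : f * v 0 j = \sum_i b i * W i j.
      rewrite -(hcomp_id (mhomogM (frame_hom frameW) (Hv j))).
      have := congr1 (fun A : 'rV_n => A 0 j) Hc; rewrite !mxE => ->.
      rewrite raddf_sum; apply: eq_bigr => i _; apply: hcompM; exact: frame_entry.
    exists (\row_i (tofrac (b i * chart_form p (d i)) / tofrac (f * h))); split.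
      move=> i; rewrite mxE; apply: local_ring_frac.
      - by apply: hcoef_mulhomog; apply: chart_form_mhomog.
      - exact: mhomogM (frame_hom frameW) Hh.
      - by rewrite mevalM mulf_neq0.
    apply/rowP=> j; rewrite !mxE.
    apply: (mulfI (tofrac_neq0 fp')); rewrite mulrA -tofracM Hb raddf_sum /=.
    rewrite mulr_suml mulr_sumr; apply: eq_bigr => i _; rewrite !mxE !tofracM.
    exact: frac_rescale (tofrac_neq0 fp') (tofrac_neq0 (hp' i)).
  apply: stalk_mulmx => // i; exists (d i), (row i W), (chart_form p (d i)).
  split=> //; [exact: frame_span frameW _ | exact: (frame_row frameW)|exact: chart_form_mhomog|].
  by apply/rowP=> j; rewrite !mxE.
have : c *m colsub J (local_rows p W d) = 0.
  by rewrite mulmx_colsub cw0; apply/matrixP=> i j; rewrite !mxE.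
have Hd : \det (colsub J (local_rows p W d)) != 0.
  rewrite det_local_rows; apply: mulf_neq0; last by rewrite tofrac_eq0.
  apply: mulf_neq0 (tofrac_neq0 fp') _.
  by rewrite invr_eq0; apply/prodf_neq0 => i _; apply: tofrac_neq0 (hp' i).
move/(congr1 (mulmx^~ (\adj (colsub J (local_rows p W d))))).
rewrite -mulmxA mul_mx_adj mul0mx mul_mx_scalar => /eqP.
by rewrite scaler_eq0 (negPf Hd) => /eqP.
Qed.

End OneFrame.

Hypothesis P_neq0 : exists J, P J != 0.

(** The rows of a frame at [p], divided by forms attached to [p], remain a basis
    wherever neither [f] nor the coordinates chosen at [p] vanish. *)
Lemma framed_locally_free : framed -> locally_free (span G) m.
Proof.
move=> HG p Hp; have [f [W [df [d [fp frW]]]]] := HG p Hp.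
exists (fun c => df c + 1)%N, (f * chart_form p (fun=> 1%N)); split.
- by apply: mhomogM (frame_hom frW) _; apply: chart_form_mhomog.
- by rewrite mevalM mulf_neq0 // chart_form_neq0.
exists (local_rows p W d) => p' _; rewrite mevalM mulf_eq0 negb_or.
by case/andP => fp' cp'; exact (frame_basis frW P_neq0 fp' cp').
Qed.

(** The minors of the local basis are [P] times the quotient of [f] by the
    product of the forms dividing the rows, and this quotient generates the stalk
    of O(e) at [p]. *)
Lemma framed_has_degree : framed -> has_degree (span G) m e.
Proof.
move=> HG; exists (fun J => tofrac (P J)); split.
  by have [J PJ] := P_neq0; exists J; rewrite tofrac_eq0.
move=> p Hp u; have [f [W [df [d [fp frW]]]]] := HG p Hp.
have hp i : (chart_form p i).@[p] != 0 by apply: chart_form_neq0.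
apply: iff_trans (det_stalk_basis _ (frame_basis frW P_neq0 fp (hp _))) _.
pose h := \prod_i chart_form p (d i).
have hp0 : h.@[p] != 0 by rewrite rmorph_prod; apply/prodf_neq0 => i _; apply: hp.
have Hh : mhomog (fun c => \sum_i d i c)%N h.
  exact: (mhomog_prod _ (fun i => chart_form_mhomog p (d i))).
have Eh : \prod_i tofrac (chart_form p (d i)) = tofrac h by rewrite rmorph_prod.
have He c : (df c)%:Z - (\sum_i d i c)%N%:Z = e c.
  by rewrite -(frame_deg frW) (big_morph Posz PoszD (erefl _)).
split=> -[c [Hc Hu]].
  exists (c * (tofrac f / tofrac h)); split; last first.
    by move=> J; rewrite Hu (det_local_rows frW) Eh !mulrA.
  have Hfh : twist_stalk e p (tofrac f / tofrac h).
    by exists df, (fun c => \sum_i d i c)%N, f, h; split=> //; apply: frame_hom frW.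
  by apply: eq_twist_stalk (twist_stalkM Hc Hfh) => c'; rewrite add0r.
exists (c * (tofrac h / tofrac f)); split; last first.
  move=> J; rewrite Hu (det_local_rows frW) Eh.
  exact: frac_cancel (tofrac_neq0 fp) (tofrac_neq0 hp0).
have Hfh : twist_stalk (fun c => - e c) p (tofrac h / tofrac f).
  exists (fun c => \sum_i d i c)%N, df, h, f; split=> //; first exact: frame_hom frW.
  by move=> c'; rewrite -He opprB.
by apply: eq_twist_stalk (twist_stalkM Hc Hfh) => c'; rewrite subrr.
Qed.

End Frames.

(** * Restriction of forms to a fibre over P^1_[s,t] *)

Section Substitution.
Variable k : fieldType.
Local Notation R := {mpoly k[2.*2]}.
Local Notation R1 := {mpoly k[1.*2]}.

Lemma crd1_ind (Q : 'I_(1.*2) -> Prop) :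
  Q (crd0 ord0) -> Q (crd1 ord0) -> forall i, Q i.
Proof.
move=> Q0 Q1 [[|[|?]] //= Hi]; [move: Q0 | move: Q1]; congr Q; exact: val_inj.
Qed.

Lemma crd2_ind (Q : 'I_(2.*2) -> Prop) :
  Q (crd0 ord0) -> Q (crd1 ord0) -> Q (crd0 ord_max) -> Q (crd1 ord_max) ->
  forall i, Q i.
Proof.
move=> Q0 Q1 Q2 Q3 [[|[|[|[|?]]]] //= Hi];
  [move: Q0 | move: Q1 | move: Q2 | move: Q3]; congr Q; exact: val_inj.
Qed.

Lemma big_crd (T : Type) (idx : T) (op : Monoid.law idx) (F : 'I_(2.*2) -> T) :
  \big[op/idx]_i F i = op (op (op (F (crd0 ord0)) (F (crd1 ord0)))
                           (F (crd0 ord_max))) (F (crd1 ord_max)).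
Proof.
rewrite (@big_ord_recr _ _ _ 3) (@big_ord_recr _ _ _ 2) (@big_ord_recr _ _ _ 1).
rewrite (@big_ord_recr _ _ _ 0) big_ord0 Monoid.mul1m.
by congr (op (op (op _ _) _) _); congr F; apply: val_inj.
Qed.

Lemma comp4_mpolyX q (m : 'X_{1..2.*2}) (a b c d : {mpoly k[q]}) :
  'X_[m] \mPo [tuple of [:: a; b; c; d]] =
  a ^+ m (crd0 ord0) * b ^+ m (crd1 ord0) * c ^+ m (crd0 ord_max)
    * d ^+ m (crd1 ord_max).
Proof. by rewrite comp_mpolyX big_crd !(tnth_nth 0) /=. Qed.

(** Congruence of two substitutions modulo [L] can be tested on the variables.
    For [L = 0] this is the usual extensionality of substitutions. *)
Lemma mpoly_rmorph_congr n (A : comNzRingType) (L : A)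
    (u v : {rmorphism {mpoly k[n]} -> A}) (f : {mpoly k[n]}) :
  (forall a, u a%:MP = v a%:MP) ->
  (forall i, exists h, u 'X_i - v 'X_i = h * L) ->
  exists h, u f - v f = h * L.
Proof.
move=> uvC uvX; pose Q a b := exists h : A, a - b = h * L.
have QQ a : Q a a by exists 0; rewrite mul0r subrr.
have QD a b c d : Q a b -> Q c d -> Q (a + c) (b + d).
  move=> [h1 H1] [h2 H2]; exists (h1 + h2).
  by rewrite mulrDl -H1 -H2; ring.
have QM a b c d : Q a b -> Q c d -> Q (a * c) (b * d).
  move=> [h1 H1] [h2 H2]; exists (h1 * c + b * h2).
  by rewrite mulrDl mulrAC -H1 -mulrA -H2; ring.
rewrite -/(Q (u f) (v f)) (mpolyE f) !rmorph_sum.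
elim/big_ind2: _ => [|a b c d|m _]; [exact: QQ | exact: QD |].
rewrite -mul_mpolyC !rmorphM /= uvC; apply: (QM); first exact: QQ.
rewrite mpolyXE_id !rmorph_prod.
elim/big_ind2: _ => [|a b c d|i _]; [exact: QQ | exact: QM |].
rewrite !rmorphXn /=; elim: (m i) => [|j IHj]; first by rewrite !expr0.
by rewrite !exprS; apply: (QM _ _ _ _ (uvX i) IHj).
Qed.

Lemma comp_mpoly_sum n q (lq : n.-tuple {mpoly k[q]}) (I : Type) (r : seq I)
    (F : I -> {mpoly k[n]}) :
  (\sum_(i <- r) F i) \mPo lq = \sum_(i <- r) (F i \mPo lq).
Proof. exact: (raddf_sum (comp_mpoly lq)). Qed.

Section Specialize.
Variables s0 t0 : k.
Local Notation sp := (specialize s0 t0).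

Lemma specialize_is_zmod_morphism : zmod_morphism sp.
Proof. by move=> f h; rewrite /specialize raddfB. Qed.
Lemma specialize_is_monoid_morphism : monoid_morphism sp.
Proof. by split=> [|f h]; rewrite /specialize ?rmorph1 ?rmorphM. Qed.
HB.instance Definition _ :=
  GRing.isZmodMorphism.Build R R1 sp specialize_is_zmod_morphism.
HB.instance Definition _ :=
  GRing.isMonoidMorphism.Build R R1 sp specialize_is_monoid_morphism.

Lemma specializeZ a f : sp (a *: f) = a *: sp f.
Proof. by rewrite /specialize linearZ. Qed.

Lemma specialize_x : sp (varx k) = 'X_(crd0 ord0).
Proof. by rewrite /specialize comp_mpolyXU. Qed.
Lemma specialize_y : sp (vary k) = 'X_(crd1 ord0).
Proof. by rewrite /specialize comp_mpolyXU. Qed.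
Lemma specialize_s : sp (vars k) = s0%:MP.
Proof. by rewrite /specialize comp_mpolyXU. Qed.
Lemma specialize_t : sp (vart k) = t0%:MP.
Proof. by rewrite /specialize comp_mpolyXU. Qed.

Definition fibre_point (p : 'I_(1.*2) -> k) : 'I_(2.*2) -> k :=
  tnth [tuple of [:: p (crd0 ord0); p (crd1 ord0); s0; t0]].

Lemma specialize_eval p f : (sp f).@[p] = f.@[fibre_point p].
Proof.
rewrite /specialize comp_mpoly_meval; apply: meval_eq => i.
rewrite /fibre_point !(tnth_nth 0).
by elim/crd2_ind: i; rewrite /= ?mevalXU ?mevalC.
Qed.

Lemma fibre_point_point p :
  ~ (s0 = 0 /\ t0 = 0) -> point p -> point (fibre_point p).
Proof.
move=> st0 Hp c; have [->|->] : c = ord0 \/ c = ord_max.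
    by case: c => [[|[|]]] //= ?; [left|right]; apply: val_inj.
  by rewrite /fibre_point !(tnth_nth 0) /=; apply: Hp ord0.
by rewrite /fibre_point !(tnth_nth 0) /=.
Qed.

Lemma specializeX (m : 'X_{1..2.*2}) :
  sp 'X_[m] = (s0 ^+ m (crd0 ord_max) * t0 ^+ m (crd1 ord_max))
    *: ('X_(crd0 ord0) ^+ m (crd0 ord0) * 'X_(crd1 ord0) ^+ m (crd1 ord0)).
Proof.
rewrite /specialize comp4_mpolyX -mulrA mulrC -!rmorphXn /= -mpolyCM.
by rewrite mul_mpolyC.
Qed.

Lemma specialize_mhomog e f : mhomog e f -> mhomog (fun=> e ord0) (sp f).
Proof.
move=> Hf; rewrite (mpolyE f) raddf_sum /=; rewrite big_seq.
elim/big_ind: _ => [|f1 f2|m /Hf Hm]; [exact: mhomog0|exact: mhomogD|].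
rewrite specializeZ; apply: mhomogZ; rewrite specializeX; apply: mhomogZ.
have H := mhomogM (mhomogXn (m (crd0 ord0)) (@mhomog_crd0 k 1 ord0))
                  (mhomogXn (m (crd1 ord0)) (@mhomog_crd1 k 1 ord0)).
by refine (eq_mhomog _ H) => c; rewrite (ord1 c) eqxx !muln1 Hm.
Qed.

End Specialize.

(** Pullback of forms along the projection to P^1_[x,y]; it provides preimages
    under every [specialize]. *)
Definition pullback (f : R1) : R := f \mPo [tuple of [:: varx k; vary k]].

Lemma pullbackK s0 t0 : cancel pullback (specialize s0 t0).
Proof.
move=> f; have [|i|h] := mpoly_rmorph_congr (L := 0)
    (u := specialize s0 t0 \o comp_mpoly [tuple of [:: varx k; vary k]])
    (v := idfun) f.
- by move=> a; rewrite /= /specialize !comp_mpolyC.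
- exists 0; rewrite mul0r /= comp_mpolyXU.
  by elim/crd1_ind: i; rewrite /= ?specialize_x ?specialize_y subrr.
- by rewrite mulr0 => /subr0_eq.
Qed.

(** Replacing [s,t] by the multiple [s0 * w, t0 * w] of the base point amounts to
    restricting to the fibre, up to a power of [w]. *)
Lemma comp_mpoly_fibre s0 t0 (e : 'I_2 -> nat) (f w : R) : mhomog e f ->
  f \mPo [tuple of [:: varx k; vary k; s0 *: w; t0 *: w]] =
  w ^+ e ord_max * pullback (specialize s0 t0 f).
Proof.
move=> Hf; rewrite /pullback [in RHS](mpolyE f) [in LHS](mpolyE f).
rewrite (raddf_sum (specialize s0 t0)) /= !comp_mpoly_sum mulr_sumr.
rewrite big_seq [RHS]big_seq; apply: eq_bigr => m /Hf Hm.
rewrite linearZ /= specializeZ /pullback linearZ /= -scalerAr; congr (_ *: _).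
rewrite comp4_mpolyX specializeX linearZ /= rmorphM !rmorphXn /= !comp_mpolyXU /=.
rewrite -Hm !exprZn exprD -!mul_mpolyC mpolyCM; ring.
Qed.

(** The equation of the fibre over [s0,t0]. *)
Definition fibre_form (s0 t0 : k) : R := t0 *: vars k - s0 *: vart k.

Lemma fibre_form_mhomog s0 t0 :
  mhomog (fun c => (ord_max == c) : nat) (fibre_form s0 t0).
Proof.
apply: mhomogD; first exact: mhomogZ _ (mhomog_crd0 _).
by apply: mhomogN; apply: mhomogZ _ (mhomog_crd1 _).
Qed.

Lemma specialize_fibre_form s0 t0 : specialize s0 t0 (fibre_form s0 t0) = 0.
Proof.
rewrite /fibre_form raddfB /= !specializeZ specialize_s specialize_t.
by rewrite -!mul_mpolyC -!mpolyCM mulrC subrr.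
Qed.

(** A form vanishing on the fibre over [s0,t0] is a multiple of the equation
    of that fibre.  Indeed, one coordinate of the base point is nonzero, say
    [t0]; modulo the equation, [s,t] is then congruent to [s0 * w, t0 * w] with
    [w = t / t0], and [f] to a multiple of its restriction. *)
Lemma specialize_eq0 s0 t0 e f : ~ (s0 = 0 /\ t0 = 0) ->
  mhomog e f -> specialize s0 t0 f = 0 ->
  exists q, f = hcoef e (fun c => (ord_max == c) : nat) q * fibre_form s0 t0.
Proof.
move=> st0 Hf f0.
(* w is chosen so that [s,t] is congruent to w times the base point. *)
suff [w Hw] : exists w, forall i : 'I_(2.*2), exists h,
    tnth [tuple 'X_i | i < 2.*2] i
    - tnth [tuple of [:: varx k; vary k; s0 *: w; t0 *: w]] i
    = h * fibre_form s0 t0.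
  have [|i|q] := mpoly_rmorph_congr (L := fibre_form s0 t0)
    (u := comp_mpoly [tuple 'X_i | i < 2.*2])
    (v := comp_mpoly [tuple of [:: varx k; vary k; s0 *: w; t0 *: w]]) f.
  - by move=> a; rewrite /= !comp_mpolyC.
  - by have [h Hh] := Hw i; exists h; rewrite -Hh /= !comp_mpolyXU -!tnth_nth.
  rewrite /=.
  rewrite comp_mpoly_id (comp_mpoly_fibre _ _ _ Hf) f0 /pullback raddf0 mulr0 subr0.
  move=> Hq; exists q; rewrite -hcompM; last exact: fibre_form_mhomog.
  by rewrite -Hq hcomp_id.
have [s00|s00] := eqVneq s0 0; last first.
  exists (s0^-1 *: vars k) => i; rewrite tnth_mktuple (tnth_nth 0).
  elim/crd2_ind: i; rewrite /= ?scalerA ?divff // ?scale1r -?/(vart k);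
    try by exists 0; rewrite mul0r subrr.
  exists (- (s0^-1)%:MP); rewrite mulNr mul_mpolyC /fibre_form scalerBr !scalerA.
  by rewrite mulVf // scale1r opprB [t0 * _]mulrC.
have t00 : t0 != 0 by apply/eqP=> t00; apply: st0.
exists (t0^-1 *: vart k) => i; rewrite tnth_mktuple (tnth_nth 0).
elim/crd2_ind: i; rewrite /= ?scalerA ?divff // ?scale1r -?/(vars k);
  try by exists 0; rewrite mul0r subrr.
exists (t0^-1)%:MP; rewrite mul_mpolyC /fibre_form scalerBr !scalerA.
by rewrite mulVf // scale1r [s0 * _]mulrC.
Qed.

End Substitution.

(** * Fibres of a framed sheaf *)

Section Fibres.
Variables (k : fieldType) (n : nat) (s0 t0 : k).
Local Notation R := {mpoly k[2.*2]}.
Local Notation R1 := {mpoly k[1.*2]}.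
Implicit Types (G : 'rV[R]_n -> Prop).
Local Notation sp := (specialize s0 t0).

Lemma fibre_span G v : fibre s0 t0 (span G) v <-> span (fibre s0 t0 G) v.
Proof.
split=> [[u [Gu ->]]|].
  move: Gu; elim/span_ind => [|u1 u2 H1 H2|a w Gw].
  - by rewrite map_mx0; apply: span0.
  - by rewrite map_mxD; apply: spanD.
  - by rewrite map_mxZ; apply: spanZ; apply: span_gen; exists w.
elim/span_ind => [|u1 u2 [w1 [G1 ->]] [w2 [G2 ->]]|a u [w [Gw ->]]].
- by exists 0; rewrite map_mx0; split=> //; apply: span0.
- by exists (w1 + w2); rewrite map_mxD; split=> //; apply: spanD.
- exists (pullback a *: w); rewrite map_mxZ /= pullbackK; split=> //.
  exact/spanZ/span_gen.
Qed.

(** A frame at the point [p, s0, t0] restricts to a frame at [p] of the fibre,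
    provided that [fibre] is generated by the restricted generators, as
    [fibre_span] ensures. *)
Lemma framed_fibre G m e P : ~ (s0 = 0 /\ t0 = 0) ->
  @framed k 2 n G m e P ->
  framed (fibre s0 t0 G) (fun=> e ord0) (fun J => sp (P J)).
Proof.
move=> st0 HG p Hp.
have [f [W [df [d [fp frW]]]]] := HG _ (fibre_point_point st0 Hp).
exists (sp f), (map_mx sp W), (fun=> df ord0), (fun i _ => d i ord0).
split; first by rewrite specialize_eval.
split.
- exact: specialize_mhomog (frame_hom frW).
- move=> i j; rewrite !mxE; apply: (@specialize_mhomog k s0 t0 (d i)).
  exact: frame_entry frW i j.
- by move=> c; apply: (frame_deg frW).
- move=> i; apply/fibre_span; exists (row i W); split; first exact: (frame_span frW).
  by rewrite map_row.
- move=> v [u [Gu ->]]; have [c Hc] := frame_gen frW Gu.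
  by exists (map_mx sp c); rewrite -map_mxZ Hc map_mxM.
- move=> J; rewrite -map_mxsub det_map_mx (frame_minor frW) rmorphM //.
Qed.

End Fibres.

(** * Flatness of the quotient *)

Section Flatness.
Variable k : fieldType.
Local Notation R := {mpoly k[2.*2]}.
Local Notation K := {fraction {mpoly k[2.*2]}}.

Section AtPoint.
Variable p : 'I_(2.*2) -> k.
Hypothesis Hp : point p.
Let s0 := p (crd0 ord_max).
Let t0 := p (crd1 ord_max).
Local Notation sp := (specialize s0 t0).
Local Notation L := (fibre_form s0 t0).
Local Notation l := (chart_form p (fun c => (ord_max == c) : nat)).

Lemma base_point_neq0 : ~ (s0 = 0 /\ t0 = 0).
Proof. exact: Hp ord_max. Qed.

Let px : 'I_(1.*2) -> k := fun i => p (widen_ord (isT : 2 <= 4)%N i).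

Lemma specialize_eval_base f : (sp f).@[px] = f.@[p].
Proof.
rewrite specialize_eval; apply: meval_eq => i; rewrite /fibre_point (tnth_nth 0).
by elim/crd2_ind: i => //=; congr (p _); apply: val_inj.
Qed.

Lemma specialize_neq0 f : f.@[p] != 0 -> sp f != 0.
Proof.
by rewrite -specialize_eval_base; apply: contraNneq => ->; rewrite meval0.
Qed.

Lemma fibre_form_neq0 : L != 0.
Proof.
apply/eqP => /(congr1 (fun f : R => (f@_U_(crd0 ord_max), f@_U_(crd1 ord_max)))).
rewrite /fibre_form !mcoeffB !mcoeffZ !mcoeffXU !mcoeff0 /= !mulr1 !mulr0.
rewrite subr0 sub0r => -[t00 /eqP]; rewrite oppr_eq0 => /eqP s00.
exact: base_point_neq0.
Qed.

(** A local parameter of P^1_[s,t] at the image of [p]. *)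
Definition uniformizer : K := tofrac L / tofrac l.

Lemma l_eval : l.@[p] != 0. Proof. exact: chart_form_neq0. Qed.

Lemma uniformizer_base : base_local_ring p uniformizer.
Proof.
exists (fun c => (ord_max == c) : nat), L, l; split=> //.
- exact: fibre_form_mhomog.
- exact: chart_form_mhomog.
- exact: l_eval.
Qed.

Lemma base_local u : base_local_ring p u -> local_ring p u.
Proof. by move=> [e [f [h [_ Hf Hh hp ->]]]]; apply: local_ring_frac Hf Hh hp. Qed.

Lemma base_localM u v :
  base_local_ring p u -> base_local_ring p v -> base_local_ring p (u * v).
Proof.
move=> [e1 [f1 [h1 [He1 Hf1 Hh1 hp1 ->]]]] [e2 [f2 [h2 [He2 Hf2 Hh2 hp2 ->]]]].
exists (fun c => e1 c + e2 c)%N, (f1 * f2), (h1 * h2); split.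
- by rewrite He1 He2.
- exact: mhomogM.
- exact: mhomogM.
- by rewrite mevalM mulf_neq0.
- by rewrite !tofracM invfM mulrACA.
Qed.

Lemma base_local0 : base_local_ring p 0.
Proof.
exists (fun=> 0%N), 0, 1; split=> //; [exact: mhomog0|exact: mhomog1| |].
  by rewrite meval1 oner_neq0.
by rewrite tofrac0 mul0r.
Qed.

Lemma base_local1 : base_local_ring p 1.
Proof.
exists (fun=> 0%N), 1, 1; split=> //; try exact: mhomog1.
  by rewrite meval1 oner_neq0.
by rewrite tofrac1 divr1.
Qed.

Lemma base_localX u j : base_local_ring p u -> base_local_ring p (u ^+ j).
Proof.
move=> Hu; elim: j => [|j IHj]; first by rewrite expr0; apply: base_local1.
by rewrite exprS; apply: base_localM.
Qed.

Lemma base_localN u : base_local_ring p u -> base_local_ring p (- u).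
Proof.
move=> [e [f [h [He Hf Hh hp ->]]]]; exists e, (- f), h; split=> //.
  exact: mhomogN.
by rewrite tofracN mulNr.
Qed.

(** A form in [s,t] alone is constant along the fibre, so its value at [p]
    decides whether it vanishes there. *)
Lemma base_form_root (e : 'I_2 -> nat) f :
  e ord0 = 0%N -> mhomog e f -> f.@[p] = 0 -> sp f = 0.
Proof.
move=> e0 Hf fp; have := specialize_mhomog (s0 := s0) (t0 := t0) Hf.
rewrite e0 => Hsp.
have spfC : sp f = ((sp f)@_0%MM)%:MP.
  apply/mpolyP=> m; rewrite mcoeffC.
  have [->|m0] := eqVneq m 0%MM; rewrite ?eqxx ?mulr1 // mulr0.
  apply/eqP/negPn/negP; rewrite -mcoeff_msupp => /Hsp /(_ ord0) /eqP.
  rewrite addn_eq0 => /andP[/eqP m00 /eqP m01]; case/eqP: m0.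
  by apply/mnmP; elim/crd1_ind; rewrite mnm0E.
have := specialize_eval_base f; rewrite spfC mevalC fp => ->.
by rewrite mpolyC0.
Qed.

Local Notation dS := (fun c : 'I_2 => (ord_max == c) : nat).

(** The order of vanishing at a point of a form in two variables: as long as
    the form vanishes at [p], the equation of the fibre can be divided out, which
    lowers the degree in [s,t]. *)
Lemma base_form_factor j (e : 'I_2 -> nat) f :
  e ord0 = 0%N -> e ord_max = j -> mhomog e f -> f != 0 ->
  exists i f' (e' : 'I_2 -> nat), [/\ mhomog e' f',
     forall c, (i * dS c + e' c)%N = e c, f'.@[p] != 0 & f = L ^+ i * f'].
Proof.
elim: j e f => [|j IHj] e f e0 e1 Hf fn0.
all: have [fp|fp] := eqVneq f.@[p] 0;
  last by exists 0%N, f, e; split=> //; rewrite expr0 mul1r.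
all: have [q Hq] := specialize_eq0 base_point_neq0 Hf (base_form_root e0 Hf fp).
all: move: Hq; rewrite /hcoef; case: ifP => [/forallP le|_];
  last by move=> f0; rewrite f0 mul0r eqxx in fn0.
  by have := le ord_max; rewrite eqxx e1.
move=> Hq; have := IHj _ (hcomp (fun c => e c - dS c)%N q) _ _ (hcomp_mhomog _ _).
case=> [|||i [f' [e' [Hf' He' fp' Ef']]]].
- by rewrite e0.
- by rewrite eqxx e1 subn1.
- by apply: contraNneq fn0 => q0; rewrite Hq q0 mul0r.
exists i.+1, f', e'; split=> // [c|].
  by rewrite mulSn -addnA He' subnKC // le.
by rewrite Hq Ef' [LHS]mulrC mulrA -exprS.
Qed.

Lemma base_valuation u : base_local_ring p u -> u != 0 ->
  exists j v, [/\ base_local_ring p v, base_local_ring p v^-1, v != 0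
                & u = uniformizer ^+ j * v].
Proof.
move=> [e [f [h [e0 Hf Hh hp ->]]]] u0.
have fn0 : f != 0 by apply: contraNneq u0 => ->; rewrite tofrac0 mul0r.
have [i [f' [e' [Hf' He' fp' Ef]]]] := base_form_factor e0 (erefl _) Hf fn0.
have lp : (l ^+ i).@[p] != 0 by rewrite rmorphXn expf_neq0 // l_eval.
have Hl : mhomog e (l ^+ i * f').
  exact: eq_mhomog He' (mhomogM (mhomogXn i (chart_form_mhomog _ _)) Hf').
have lfp : (l ^+ i * f').@[p] != 0 by rewrite mevalM mulf_neq0.
exists i, (tofrac (l ^+ i * f') / tofrac h); split.
- by exists e, (l ^+ i * f'), h.
- by rewrite invf_div; exists e, h, (l ^+ i * f').
- exact: mulf_neq0 (tofrac_neq0 lfp) (invr_neq0 (tofrac_neq0 hp)).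
rewrite Ef !tofracM !tofracXn.
exact: frac_valuation (tofrac_neq0 l_eval).
Qed.

(** The equation [L] of the fibre is prime, as it generates the kernel of
    [specialize]; and it does not divide [d1].  So the denominator of [y], which
    divides both [L] and [d1] up to units, is a unit. *)
Lemma uniformizer_pure y d1 d2 :
  d2.@[p] != 0 -> sp d1 != 0 ->
  local_ring p (y * uniformizer) -> local_ring p (y * (tofrac d1 / tofrac d2)) ->
  local_ring p y.
Proof.
move=> d2p d1n0 /local_ringP[e [a [b [Ha Hb bp Ey]]]].
move=> /local_ringP[e' [c [b' [Hc Hb' bp' Ey']]]].
have L0 : tofrac L != 0 by rewrite tofrac_eq0 fibre_form_neq0.
have l0 := tofrac_neq0 l_eval.
have b0 := tofrac_neq0 bp; have b'0 := tofrac_neq0 bp'; have d20 := tofrac_neq0 d2p.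
have Ey1 : y = tofrac a / tofrac b * (tofrac l / tofrac L).
  exact: frac_solve L0 l0 Ey.
have key : a * l * d1 * b' = c * d2 * b * L.
  apply/eqP; rewrite -tofrac_eq; apply/eqP; rewrite !tofracM.
  exact: frac_cross b0 L0 d20 b'0 Ey1 Ey'.
have spa : sp a = 0.
  have := congr1 sp key; rewrite !rmorphM /= specialize_fibre_form mulr0 => /eqP.
  rewrite !mulf_eq0 (negPf d1n0) (negPf (specialize_neq0 bp')) !orbF.
  by rewrite (negPf (specialize_neq0 l_eval)) orbF => /eqP.
have [q Hq] := specialize_eq0 base_point_neq0 Ha spa.
rewrite Ey1 Hq tofracM.
have -> : tofrac (hcoef e dS q) * tofrac L / tofrac b * (tofrac l / tofrac L) =
          tofrac (hcoef e dS q * l) / tofrac b.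
  by rewrite tofracM; exact: frac_exchange L0.
exact: local_ring_frac (hcoef_mulhomog _ _ (chart_form_mhomog _ _)) Hb bp.
Qed.

Lemma base_pure y u d1 d2 : base_local_ring p u -> u != 0 ->
  d2.@[p] != 0 -> sp d1 != 0 ->
  local_ring p (y * u) -> local_ring p (y * (tofrac d1 / tofrac d2)) ->
  local_ring p y.
Proof.
move=> Hu u0 d2p d1n0; have [j [v [_ Hv v0 ->]]] := base_valuation Hu u0.
move=> Hyu Hyd; have : local_ring p (y * uniformizer ^+ j).
  by have := local_ringM Hyu (base_local Hv); rewrite mulrA mulfK.
elim: j {Hyu} => [|j IHj]; first by rewrite expr0 mulr1.
rewrite exprSr mulrA => /uniformizer_pure Hj; apply: IHj.
apply: Hj d2p d1n0 _; rewrite mulrAC; apply: local_ringM Hyd _.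
exact/base_local/base_localX/uniformizer_base.
Qed.

(** The local ring of the base is a discrete valuation ring: among finitely many
    elements, one of minimal valuation divides the others. *)
Lemma base_local_gcd (I : finType) (a : I -> K) :
  (forall i, base_local_ring p (a i)) -> (exists i, a i != 0) ->
  exists i0, a i0 != 0 /\
    exists c : I -> K, forall i, base_local_ring p (c i) /\ a i = c i * a i0.
Proof.
move=> Ha [i1 ai1].
have Hval i : exists j, a i != 0 -> exists v,
    [/\ base_local_ring p v, base_local_ring p v^-1, v != 0
      & a i = uniformizer ^+ j * v].
  have [ai|ai] := eqVneq (a i) 0; first by exists 0%N.
  by have [j Hj] := base_valuation (Ha i) ai; exists j.
case/(fin_all_exists (P := fun i j => _)): Hval => val Hval.
case: (@arg_minnP _ i1 (fun i => a i != 0) val ai1) => i0 ai0 Hmin; exists i0; split=> //.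
have Hc i : exists c, base_local_ring p c /\ a i = c * a i0.
  have [ai|ai] := eqVneq (a i) 0.
    by exists 0; rewrite ai mul0r; split=> //; apply: base_local0.
  have [v [Hv _ _ ->]] := Hval i ai.
  have [v0 [_ Hv0 v0n0 ->]] := Hval i0 ai0.
  exists (uniformizer ^+ (val i - val i0) * (v * v0^-1)); split.
    apply: base_localM; last exact: base_localM.
    exact/base_localX/uniformizer_base.
  exact: frac_power_quotient v0n0 (Hmin i ai).
by case/(fin_all_exists (P := fun i c => _)): Hc => c Hc; exists c.
Qed.

(** Absence of torsion over the base in the stalk of the quotient of O^n.  If
    [u *: v] is the combination [c *m w] of the local basis, then [v] has
    coordinates [u^-1 *: c], which lie in the local ring: multiplied by [u] they
    do by definition, and multiplied by a minor of [w] they do by Cramer's rule.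
    Since the minor is not identically zero on the fibre, it is prime to [u]. *)
Lemma framed_stalk_pure n G m e P u (v : 'rV[K]_n) :
  @framed k 2 n G m e P ->
  (exists J, specialize s0 t0 (P J) != 0) ->
  base_local_ring p u -> u != 0 -> (forall j, local_ring p (v 0 j)) ->
  stalk (span G) p (u *: v) -> stalk (span G) p v.
Proof.
move=> HG [J PJ] Hu u0 Hv; have [f [W [df [d [fp frW]]]]] := HG p Hp.
have PJ0 : P J != 0 by apply: contraNneq PJ => ->; rewrite raddf0.
have cp i : (chart_form p i).@[p] != 0 by apply: chart_form_neq0.
have := frame_basis frW (ex_intro _ J PJ0) fp (cp _).
set w := local_rows p W d => -[Hw _] /Hw [c [Hc Ev]]; apply/Hw.
exists (u^-1 *: c); split; last by rewrite -scalemxAl -Ev scalerA mulVf // scale1r.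
move=> i; pose h := \prod_i chart_form p (d i).
have hp : h.@[p] != 0 by rewrite rmorph_prod; apply/prodf_neq0 => i' _; apply: cp.
have spfP : sp (f * P J) != 0.
  by rewrite rmorphM /=; apply: mulf_neq0 (specialize_neq0 fp) PJ.
apply: (base_pure Hu u0 hp spfP).
  by rewrite mxE mulrAC mulVf // mul1r; apply: Hc.
have Ed : tofrac (f * P J) / tofrac h = \det (colsub J w).
  by rewrite (det_local_rows frW) rmorphM rmorph_prod mulrAC.
have Ew : (u^-1 *: c) *m colsub J w = colsub J v.
  by rewrite mulmx_colsub -scalemxAl -Ev scalerA mulVf // scale1r.
have -> : (u^-1 *: c) 0 i * (tofrac (f * P J) / tofrac h) =
    (colsub J v *m \adj (colsub J w)) 0 i.
  by rewrite -Ew -mulmxA mul_mx_adj mul_mx_scalar Ed [RHS]mxE mulrC.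
apply: local_ring_mulmx => [i' j|]; first by rewrite mxE (ord1 i').
apply: local_ring_adj => i' j; rewrite /w !mxE.
apply: local_ring_frac (cp _); last exact: chart_form_mhomog.
exact: frame_entry frW _ _.
Qed.

End AtPoint.

(** Over the discrete valuation ring of the base, torsion-free implies flat: in
    a relation, the coefficient of least valuation can be cancelled, which solves
    for the corresponding vector in terms of the others. *)
Lemma framed_flat n G m e P :
  @framed k 2 n G m e P ->
  (forall s0 t0, ~ (s0 = 0 /\ t0 = 0) -> exists J, specialize s0 t0 (P J) != 0) ->
  flat_quotient (span G).
Proof.
move=> HG HP p Hp l a v Ha Hv Hav.
(* If all coefficients vanish, the relation is trivial. *)
have [a0|] := boolP [forall i, a i == 0].
  exists l, (fun i j => (i == j)%:R), v; split=> // [i j|i|j].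
  - by case: (i == j); [apply: base_local1 | apply: base_local0].
  - rewrite (bigD1 i) //= eqxx scale1r big1 ?addr0 ?subrr; first exact: stalk0.
    by move=> j /negPf; rewrite eq_sym => ->; rewrite scale0r.
  - by rewrite big1 // => i _; rewrite (eqP (forallP a0 i)) mul0r.
rewrite negb_forall => /existsP Hex.
have [i0 [ai0 [c Hc]]] := base_local_gcd Hp Ha Hex.
have ci0 : c i0 = 1.
  by have [_ E] := Hc i0; apply: (mulIf ai0); rewrite -E mul1r.
have Hsum : stalk (span G) p (\sum_i c i *: v i).
  apply: (framed_stalk_pure Hp HG (HP _ _ (base_point_neq0 Hp)) (Ha i0) ai0).
    move=> j; rewrite summxE; apply: local_ring_sum => i; rewrite mxE.
    by apply: local_ringM (Hv i j); apply: base_local; case: (Hc i).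
  rewrite scaler_sumr; congr (stalk _ _ _): Hav; apply: eq_bigr => i _.
  by rewrite scalerA mulrC; case: (Hc i) => _ <-.
(* v_i0 is congruent to - \sum_(j != i0) c j *: v j, and the other v_j stand for
   themselves. *)
exists l, (fun i j => if i == i0 then (if j == i0 then 0 else - c j) else (i == j)%:R), v.
split=> // [i j|i|j].
- case: (i == i0); case: (_ == _); try exact: base_local0; try exact: base_local1.
  by apply: base_localN; case: (Hc j).
- have [->|ii0] := eqVneq i i0.
    congr (stalk _ _ _): Hsum.
    rewrite (bigD1 i0) //= ci0 scale1r [in RHS](bigD1 i0) //= eqxx scale0r add0r.
    rewrite -sumrN; congr (_ + _); apply: eq_bigr => j /negPf ->.
    by rewrite scaleNr opprK.
  rewrite (bigD1 i) //= eqxx scale1r big1 ?addr0 ?subrr; first exact: stalk0.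
  by move=> j /negPf; rewrite eq_sym => ->; rewrite scale0r.
- rewrite (bigD1 i0) //= eqxx; have [->|ji0] := eqVneq j i0.
    by rewrite mulr0 add0r big1 // => i /negPf ->; rewrite mulr0.
  rewrite (bigD1 j) //= (negPf ji0) eqxx mulr1 big1.
    by rewrite addr0 mulrN; case: (Hc j) => _ ->; rewrite mulrC addrC subrr.
  by move=> i /andP[/negPf -> /negPf ->]; rewrite mulr0.
Qed.

End Flatness.

(** * The torus action *)

Section Torus.
Variables (k : fieldType) (n : nat).
Local Notation R := {mpoly k[2.*2]}.
Implicit Types (G : 'rV[R]_n -> Prop) (z : 'I_n -> k) (q cs ct : k).

Definition torus_subst q cs ct : (2.*2).-tuple R :=
  [tuple of [:: q *: varx k; vary k; cs *: vars k; ct *: vart k]].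

Lemma torus_actE z q cs ct v i :
  torus_act z q cs ct v 0 i = z i *: (v 0 i \mPo torus_subst q cs ct).
Proof. by rewrite mxE. Qed.

Lemma torus_act0 z q cs ct : torus_act z q cs ct 0 = 0.
Proof. by apply/rowP=> i; rewrite torus_actE !mxE comp_mpoly0 scaler0. Qed.

Lemma torus_actD z q cs ct u v :
  torus_act z q cs ct (u + v) = torus_act z q cs ct u + torus_act z q cs ct v.
Proof.
apply/rowP=> i; rewrite [RHS]mxE !torus_actE mxE.
by rewrite (raddfD (comp_mpoly (torus_subst q cs ct))) scalerDr.
Qed.

Lemma torus_actZ z q cs ct (a : R) v :
  torus_act z q cs ct (a *: v) =
  (a \mPo torus_subst q cs ct) *: torus_act z q cs ct v.
Proof.
apply/rowP=> i; rewrite [RHS]mxE !torus_actE mxE.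
by rewrite (rmorphM (comp_mpoly (torus_subst q cs ct))) scalerAr.
Qed.

Lemma torus_substK q cs ct a : q != 0 -> cs != 0 -> ct != 0 ->
  (a \mPo torus_subst q^-1 cs^-1 ct^-1) \mPo torus_subst q cs ct = a.
Proof.
move=> q0 cs0 ct0; have [|i|h] := mpoly_rmorph_congr (L := 0)
    (u := comp_mpoly (torus_subst q cs ct)
            \o comp_mpoly (torus_subst q^-1 cs^-1 ct^-1))
    (v := idfun) a.
- by move=> b; rewrite /= !comp_mpolyC.
- exists 0; rewrite mul0r /= comp_mpolyXU.
  elim/crd2_ind: i; rewrite /= ?linearZ /= comp_mpolyXU /= ?scalerA ?mulVf //;
    by rewrite ?scale1r subrr.
- by rewrite mulr0 => /subr0_eq.
Qed.

Lemma torus_char_neq0 (al : 'I_n -> int) al0 z q :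
  (forall i, z i != 0) -> q != 0 -> torus_char al al0 z q != 0.
Proof.
move=> z0 q0; rewrite mulf_neq0 ?expfz_neq0 //.
by apply/prodf_neq0 => i _; rewrite expfz_neq0.
Qed.

Lemma torus_char_delta j a z q :
  torus_char (fun l => (l == j)%:Z) a%:Z z q = z j * q ^+ a.
Proof.
rewrite /torus_char (bigD1 j) //= eqxx big1 ?mulr1 // => l /negPf ->.
by rewrite expr0z.
Qed.

(** When the torus multiplies each generator by a scalar, it preserves the
    module, since it acts on the coefficients by automorphisms of the ring. *)
Lemma T_invariant_span G (al be : 'I_n -> int) (al0 be0 : int) :
  (forall z q, (forall i, z i != 0) -> q != 0 -> forall u, G u ->
    exists2 a : k, a != 0 &
      torus_act z q (torus_char al al0 z q) (torus_char be be0 z q) u = a%:MP *: u) ->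
  T_invariant (span G).
Proof.
move=> HG; exists al, be, al0, be0 => z q z0 q0.
have cs0 := torus_char_neq0 al al0 z0 q0; have ct0 := torus_char_neq0 be be0 z0 q0.
move: cs0 ct0 (HG z q z0 q0); move: (torus_char _ _ _ _) (torus_char _ _ _ _).
move=> ct cs cs0 ct0 {}HG; apply: eq_sheaf => v; split=> [[u Gu ->]|].
  move: Gu; elim/span_ind => [|u1 u2 H1 H2|b u1 Gu].
  - by rewrite torus_act0; apply: span0.
  - by rewrite torus_actD; apply: spanD.
  - rewrite torus_actZ; have [a _ ->] := HG _ Gu.
    by apply/spanZ/spanZ/span_gen.
elim/span_ind => [|v1 v2 [u1 G1 ->] [u2 G2 ->]|b u Gu].
- by exists 0; [apply: span0 | rewrite torus_act0].
- by exists (u1 + u2); [apply: spanD | rewrite torus_actD].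
- have [a a0 Ha] := HG _ Gu.
  exists (((a^-1)%:MP * (b \mPo torus_subst q^-1 cs^-1 ct^-1)) *: u).
    exact/spanZ/span_gen.
  rewrite torus_actZ Ha (rmorphM (comp_mpoly (torus_subst q cs ct))) /=.
  rewrite comp_mpolyC torus_substK // scalerA mulrAC -mpolyCM mulVf //.
  by rewrite mpolyC1 mul1r.
Qed.

End Torus.

(** * Monomials in x and y *)

Section Monomials.
Variable k : fieldType.

Lemma xymon_mhomog g a b :
  mhomog (fun c : 'I_g.+1 => ((a + b) * (ord0 == c))%N) (xymon k g a b).
Proof.
apply: eq_mhomog (mhomogM (mhomogXn a (mhomog_crd0 _)) (mhomogXn b (mhomog_crd1 _))).
by move=> c; rewrite mulnDl.
Qed.

Lemma xymonM g a b a' b' :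
  xymon k g a b * xymon k g a' b' = xymon k g (a + a') (b + b').
Proof. by rewrite /xymon !exprD mulrACA. Qed.

Lemma xymon_eval g a b p :
  (xymon k g a b).@[p] = p (crd0 ord0) ^+ a * p (crd1 ord0) ^+ b.
Proof. by rewrite mevalM !rmorphXn /= !mevalXU. Qed.

Lemma specialize_xymon s0 t0 a b :
  specialize s0 t0 (xymon k 1 a b) = xymon k 0 a b.
Proof.
by rewrite rmorphM !rmorphXn /= -/(varx k) -/(vary k) specialize_x specialize_y.
Qed.

Lemma xymonE g a b :
  xymon k g a b = 'X_[U_(crd0 ord0) *+ a + U_(crd1 ord0) *+ b].
Proof. by rewrite /xymon !mpolyXn -mpolyXD. Qed.

Lemma xymon_neq0 g a b : xymon k g a b != 0.
Proof.
apply/eqP => /(congr1 (meval (fun=> 1))).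
by rewrite xymon_eval !expr1n mulr1 meval0 => /eqP; rewrite oner_eq0.
Qed.

Lemma mcoeff_xymon g a b a' b' :
  (xymon k g a b)@_(U_(crd0 ord0) *+ a' + U_(crd1 ord0) *+ b')
   = ((a == a') && (b == b'))%:R.
Proof.
rewrite xymonE mcoeffX; congr (nat_of_bool _)%:R; apply/eqP/andP; last first.
  by case=> /eqP -> /eqP ->.
move=> /mnmP H; move: (H (crd0 ord0)) (H (crd1 ord0)).
rewrite !mnmDE !mulmnE !mnm1E !eqxx -!val_eqE /= ?muln0 ?mul0n ?muln1 ?mul1n ?addn0 ?add0n.
by move=> -> ->; rewrite !eqxx.
Qed.

Lemma vars_mhomog : mhomog (fun c => (ord_max == c) : nat) (vars k).
Proof. exact: mhomog_crd0. Qed.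

Lemma vart_mhomog : mhomog (fun c => (ord_max == c) : nat) (vart k).
Proof. exact: mhomog_crd1. Qed.

Lemma xymon_torus q cs ct a b :
  xymon k 1 a b \mPo torus_subst q cs ct = (q ^+ a)%:MP * xymon k 1 a b.
Proof.
rewrite (rmorphM (comp_mpoly (torus_subst q cs ct))) !rmorphXn /= !comp_mpolyXU /=.
by rewrite exprZn -mul_mpolyC -mulrA rmorphXn.
Qed.

End Monomials.
Arguments xymon_mhomog k g a b : clear implicits.
Arguments vars_mhomog k : clear implicits.
Arguments vart_mhomog k : clear implicits.

(** * Frames made of one vector for each selected index *)

Section RowFrames.
Variables (k : fieldType) (g n : nat) (A : pred 'I_n).
Local Notation R := {mpoly k[g.*2]}.
Implicit Types (G : 'rV[R]_n -> Prop) (rho : 'I_n -> 'rV[R]_n).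

Definition row_mat rho : 'M[R]_(#|A|, n) := \matrix_a rho (enum_val a).

Definition minors rho (J : {ffun 'I_#|A| -> 'I_n}) : R :=
  \det (colsub J (row_mat rho)).

Definition replace_row rho i w : 'I_n -> 'rV[R]_n :=
  fun l => if l == i then w else rho l.

(** A row operation.  The factor [c] of the new row allows for coefficients that
    are fractions. *)
Lemma minors_replace rho i j w (c a b : R) J : A i -> A j -> i != j ->
  c *: w = a *: rho i + b *: rho j ->
  c * minors (replace_row rho i w) J = a * minors rho J.
Proof.
move=> Ai Aj ij Hw.
pose i' := enum_rank_in Ai i; pose j' := enum_rank_in Ai j.
have Ei : enum_val i' = i by rewrite enum_rankK_in.
have Ej : enum_val j' = j by rewrite enum_rankK_in.
have ji' : j' != i' by apply: contraNneq ij => E; rewrite -Ei -Ej E.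
have row'E w1 w2 : row' i' (colsub J (row_mat (replace_row rho i w1))) =
                   row' i' (colsub J (row_mat (replace_row rho i w2))).
  apply/matrixP=> a' b'; rewrite !mxE /replace_row.
  case: eqP => // E; have : lift i' a' = i' by apply: enum_val_inj; rewrite E.
  by move/eqP; rewrite eq_sym (negPf (neq_lift _ _)).
have rowE w1 : row i' (colsub J (row_mat (replace_row rho i w1))) =
               \row_b w1 0 (J b).
  by apply/rowP=> b'; rewrite !mxE /replace_row Ei eqxx.
have minE w1 w2 w3 c1 c2 : w1 = c1 *: w2 + c2 *: w3 ->
    minors (replace_row rho i w1) J =
    c1 * minors (replace_row rho i w2) J + c2 * minors (replace_row rho i w3) J.
  move=> Ew; apply: (determinant_multilinear (i0 := i')).
  - by rewrite !rowE; apply/rowP=> b'; rewrite !mxE Ew !mxE.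
  - exact: row'E.
  - exact: row'E.
have rho_id : minors (replace_row rho i (rho i)) J = minors rho J.
  by rewrite /minors; congr (\det _); apply/matrixP=> a' b'; rewrite !mxE /replace_row;
    case: eqP => [->|].
have rho_j : minors (replace_row rho i (rho j)) J = 0.
  apply: (determinant_alternate (negbT (introF eqP _) : i' != j')).
    by move=> E; rewrite E eqxx in ji'.
  move=> b'; rewrite !mxE /replace_row Ei Ej eqxx; by case: eqP.
have := minE (c *: w) w w c 0; rewrite scale0r addr0 mul0r addr0 => <- //.
by rewrite (minE _ _ _ _ _ Hw) rho_id rho_j mulr0 addr0.
Qed.

(** [th] selects one column for each row, so that the submatrix is diagonal. *)
Lemma minors_diag rho (th : 'I_n -> 'I_n) :
  (forall l l', A l -> A l' -> l != l' -> rho l 0 (th l') = 0) ->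
  minors rho [ffun a => th (enum_val a)] = \prod_(l | A l) rho l 0 (th l).
Proof.
move=> Hth; rewrite /minors.
have -> : colsub [ffun a => th (enum_val a)] (row_mat rho) =
   diag_mx (\row_(a < #|A|) rho (enum_val a) 0 (th (enum_val a))).
  apply/matrixP=> a b; rewrite !mxE ffunE.
  have [->|ab] := eqVneq a b; first by rewrite mulr1n.
  rewrite mulr0n; apply: Hth; try exact: enum_valP.
  by apply: contraNneq ab => /enum_val_inj ->.
rewrite det_diag.
apply: (@etrans _ _ (\prod_(a < #|A|) rho (enum_val a) 0 (th (enum_val a)))).
  by apply: eq_bigr => a _; rewrite mxE.
apply/esym; exact: (big_enum_val (A := A) (fun l => rho l 0 (th l))).
Qed.

Lemma row_frame G (e : 'I_g -> int) P f rho df (D : 'I_n -> 'I_g -> nat) :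
  mhomog df f -> (forall l, A l -> mhomogv (D l) (rho l)) ->
  (forall c, (df c)%:Z - (\sum_(l | A l) D l c)%N%:Z = e c) ->
  (forall l, A l -> span G (rho l)) ->
  (forall u, G u -> span (fun v => exists l, A l /\ v = rho l) (f *: u)) ->
  (forall J, minors rho J = f * P J) ->
  frame G e P f (row_mat rho) df (fun a => D (enum_val a)).
Proof.
move=> Hf Hrho He Grho HG HP; have AP (a : 'I_#|A|) : A (enum_val a) := enum_valP a.
split=> //.
- by move=> a; rewrite rowK; apply: Hrho.
- move=> c; rewrite -He; congr (_ - _).
  rewrite -(big_morph Posz PoszD (erefl _)); congr Posz; apply/esym.
  exact: (big_enum_val (A := A)).
- by move=> a; rewrite rowK; apply: Grho.
- move=> u /HG; elim/span_ind => [|u1 u2 [c1 ->] [c2 ->]|a _ [l [Al ->]]].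
  + by exists 0; rewrite mul0mx.
  + by exists (c1 + c2); rewrite mulmxDl.
  + exists (a *: delta_mx 0 (enum_rank_in Al l)).
    by rewrite -scalemxAl -rowE rowK enum_rankK_in.
Qed.

End RowFrames.
Arguments minors {k g n} A rho J.
Arguments row_mat {k g n} A rho.

(** * Three generators subject to one relation *)

Section Pencil.
Variables (k : fieldType) (g n : nat) (A : pred 'I_n).
Local Notation R := {mpoly k[g.*2]}.
Variables (G : 'rV[R]_n -> Prop) (e : 'I_g -> int) (rho : 'I_n -> 'rV[R]_n).
Variables (D : 'I_n -> 'I_g -> nat) (i j : 'I_n).
Variables (kap lam mu : R) (g3 : 'rV[R]_n) (dkap dlam dmu d3 : 'I_g -> nat).

Hypotheses (Ai : A i) (Aj : A j) (ij : i != j) (kap0 : kap != 0).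
Hypothesis relation : kap *: g3 = lam *: (kap *: rho i) + mu *: rho j.
Hypotheses (Hkap : mhomog dkap kap) (Hlam : mhomog dlam lam) (Hmu : mhomog dmu mu).
Hypothesis Hrho : forall l, A l -> mhomogv (D l) (rho l).
Hypothesis Hg3 : mhomogv d3 g3.
Hypothesis deg_lam : forall c, d3 c = (dlam c + D i c)%N.
Hypothesis deg_mu : forall c, (dkap c + d3 c)%N = (dmu c + D j c)%N.
Hypothesis He : forall c, - (\sum_(l | A l) D l c)%N%:Z = e c.
Hypothesis cover : forall p, point p ->
  [\/ kap.@[p] != 0, lam.@[p] != 0 | mu.@[p] != 0].
Hypothesis HG : forall u, G u <->
  [\/ u = kap *: rho i, u = rho j, u = g3
    | exists l, [/\ A l, l != i, l != j & u = rho l]].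

Local Notation rows w1 w2 := (replace_row (replace_row rho i w1) j w2).
Local Notation g1 := (kap *: rho i).
Local Notation g2 := (rho j).

(** A chart of the sheaf spanned by [g1], [g2], [g3] and the other [rho l]: two of
    the three generators, [w1] and [w2], replace the rows [i] and [j]. *)
Lemma pencil_chart f df w1 w2 d1 d2 : mhomog df f ->
  mhomogv d1 w1 -> mhomogv d2 w2 -> G w1 -> G w2 ->
  (forall c, df c + (D i c + D j c) = d1 c + d2 c)%N ->
  (forall u, [\/ u = g1, u = g2 | u = g3] ->
     exists x y, f *: u = x *: w1 + y *: w2) ->
  (forall J, minors A (rows w1 w2) J = f * minors A rho J) ->
  exists W df d, frame G e (minors A rho) f W df d.
Proof.
move=> Hf Hw1 Hw2 Gw1 Gw2 Hdeg Hgen Hmin.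
have ji : (j == i) = false by rewrite eq_sym (negPf ij).
pose D' l := if l == j then d2 else if l == i then d1 else D l.
exists (row_mat A (rows w1 w2)), df, (fun a => D' (enum_val a)).
have rowi : rows w1 w2 i = w1 by rewrite /replace_row (negPf ij) eqxx.
have rowj : rows w1 w2 j = w2 by rewrite /replace_row eqxx.
have rowl l : l != i -> l != j -> rows w1 w2 l = rho l.
  by rewrite /replace_row => /negPf -> /negPf ->.
apply: row_frame => //.
- move=> l Al; rewrite /replace_row /D'; case: (l =P j) => // _.
  by case: (l =P i) => // _; apply: Hrho.
- move=> c; rewrite -He (bigD1 i) //= (bigD1 j) ?Aj 1?eq_sym //=.
  rewrite [in RHS](bigD1 i) //= [in RHS](bigD1 j) ?Aj 1?eq_sym //=.
  rewrite /D' (negPf ij) !eqxx.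
  rewrite (eq_bigr (fun l => D l c)); last first.
    by move=> l /andP[/andP[_ /negPf ->] /negPf ->].
  by have := Hdeg c; lia.
- move=> l Al; apply: span_gen; rewrite /replace_row; case: (l =P j) => // /eqP lj.
  by case: (l =P i) => // /eqP li; apply/HG; constructor 4; exists l.
- have H u : [\/ u = g1, u = g2 | u = g3] ->
      span (fun v => exists l, A l /\ v = rows w1 w2 l) (f *: u).
    move=> /Hgen[x [y ->]]; apply: spanD; apply: spanZ; apply: span_gen.
      by exists i.
    by exists j.
  move=> u /HG[->|->|->|[l [Al li lj ->]]].
  + by apply: H; constructor 1.
  + by apply: H; constructor 2.
  + by apply: H; constructor 3.
  + by apply: spanZ; apply: span_gen; exists l; rewrite rowl.
Qed.

Lemma minors_rows w1 w2 x1 x2 y1 y2 f1 f2 J :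
  x1 *: w1 = f1 *: rho i + y1 *: rho j ->
  x2 *: w2 = f2 *: rho j + y2 *: w1 ->
  x1 * x2 * minors A (rows w1 w2) J = f1 * f2 * minors A rho J.
Proof.
move=> H1 H2; have ji : j != i by rewrite eq_sym.
rewrite -mulrA (@minors_replace _ _ _ _ _ j i w2 x2 f2 y2) //; last first.
  by rewrite /replace_row (negPf ji) eqxx.
by rewrite mulrCA (@minors_replace _ _ _ _ _ i j w1 x1 f1 y1) // mulrCA mulrA.
Qed.

(** Each of the three generators is a combination of the other two where its
    coefficient in the relation is nonzero, and that coefficient is also the
    ratio of the minors of the other two to those of [rho]: solving
    [kap *: g3 = lam *: g1 + mu *: g2] for one generator multiplies the
    determinant by the ratio of two coefficients, while [g1 = kap *: rho i]. *)
Lemma pencil_framed : framed G e (minors A rho).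
Proof.
move=> p Hp.
have G1 : G g1 by apply/HG; constructor 1.
have G2 : G g2 by apply/HG; constructor 2.
have G3 : G g3 by apply/HG; constructor 3.
have Hg1 : mhomogv (fun c => dkap c + D i c)%N g1.
  by move=> l; rewrite mxE; apply: mhomogM Hkap _; apply: Hrho.
have Hg2 : mhomogv (D j) g2 by apply: Hrho.
suff [f [W [df [d [fp H]]]]] :
    exists f W df d, f.@[p] != 0 /\ frame G e (minors A rho) f W df d.
  by exists f, W, df, d.
(* The three charts omit g3, g1 and g2 respectively. *)
case: (cover Hp) => fp.
- have [|||W [df [d H]]] := pencil_chart Hkap Hg1 Hg2 G1 G2; last by exists kap, W, df, d.
  + by move=> c; rewrite addnA.
  + move=> u [->|->|->]; [exists kap, 0|exists 0, kap|exists lam, mu].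
    * by rewrite scale0r addr0.
    * by rewrite scale0r add0r.
    * exact: relation.
  + move=> J; have := @minors_rows g1 g2 1 1 0 0 kap 1 J.
    by rewrite !mul1r mulr1 !scale1r !scale0r !addr0; apply.
- have [|||W [df [d H]]] := pencil_chart Hlam Hg3 Hg2 G3 G2; last by exists lam, W, df, d.
  + by move=> c; rewrite deg_lam addnA.
  + move=> u [->|->|->]; [exists kap, (- mu)|exists 0, lam|exists lam, 0].
    * by rewrite relation scaleNr addrK.
    * by rewrite scale0r add0r.
    * by rewrite scale0r addr0.
  + move=> J; apply: (mulfI kap0); rewrite mulrA.
    have := @minors_rows g3 g2 kap 1 mu 0 (kap * lam) 1 J.
    rewrite !mulr1 => ->; rewrite ?scale1r ?scale0r ?addr0 //.
    by rewrite relation scalerA [lam * _]mulrC.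
- have [|||W [df [d H]]] := pencil_chart Hmu Hg1 Hg3 G1 G3; last by exists mu, W, df, d.
  + by move=> c; have := deg_mu c; lia.
  + move=> u [->|->|->]; [exists mu, 0|exists (- lam), kap|exists 0, mu].
    * by rewrite scale0r addr0.
    * by rewrite relation scaleNr addKr.
    * by rewrite scale0r add0r.
  + move=> J; apply: (mulfI kap0); rewrite mulrA.
    have := @minors_rows g1 g3 1 kap 0 lam kap mu J.
    rewrite !mul1r => -> //; first by rewrite scale1r scale0r addr0.
    by rewrite relation addrC.
Qed.

End Pencil.

(** * From a frame to an invariant curve *)

Section Claims.
Variables (k : fieldType) (n : nat).
Local Notation R := {mpoly k[2.*2]}.
Implicit Types (G : 'rV[R]_n -> Prop) (phi : triple n).

Lemma fibre_sheaf_eq s0 t0 G (H : 'rV[{mpoly k[1.*2]}]_n -> Prop) :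
  (forall u, G u -> span H (map_mx (specialize s0 t0) u)) ->
  (forall p, point p -> exists e f, [/\ mhomog e f, f.@[p] != 0
     & forall u, H u -> span (fibre s0 t0 G) (f *: u)]) ->
  sheaf_eq (fibre s0 t0 (span G)) (span H).
Proof.
move=> GH HG p Hp w; apply: iff_trans (eq_sheaf (fibre_span s0 t0 G) Hp w) _.
by apply: sheaf_eq_span => // u [v [Gv ->]]; apply: GH.
Qed.

Definition curve_claims (d r : nat) phi phi' (es : int) (M : 'rV[R]_n -> Prop) :=
  [/\ T_invariant M,
      locally_free M (n - r) /\
      has_degree M (n - r) (fun c : 'I_2 => if c == ord0 then - d%:Z else es),
      sheaf_eq (fibre 1 0 M) (fixed_sheaf k n phi),
      sheaf_eq (fibre 0 1 M) (fixed_sheaf k n phi')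
    & T_invariant_curve d r M].

(** Restricted to a fibre, a frame remains a frame, with the restricted minors; as
    these do not all vanish, each fibre is locally free of the same degree in
    [x,y], and the quotient is flat. *)
Lemma framed_claims d r m phi phi' es G P : m = (n - r)%N ->
  framed G (fun c : 'I_2 => if c == ord0 then - d%:Z else es) P ->
  (forall s0 t0, ~ (s0 = 0 /\ t0 = 0) ->
     exists J : {ffun 'I_m -> 'I_n}, specialize s0 t0 (P J) != 0) ->
  (forall u, G u -> exists e, mhomogv e u) ->
  T_invariant (span G) ->
  sheaf_eq (fibre 1 0 (span G)) (fixed_sheaf k n phi) ->
  sheaf_eq (fibre 0 1 (span G)) (fixed_sheaf k n phi') ->
  curve_claims d r phi phi' es (span G).
Proof.
move=> Hm; subst m => HG HP Ghom GT G10 G01.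
have P0 : exists J, P J != 0.
  have [|J PJ] := HP 1 0; first by case=> /eqP; rewrite oner_eq0.
  by exists J; apply: contraNneq PJ => ->; rewrite raddf0.
split=> //; first by split; [apply: framed_locally_free P0 HG|apply: framed_has_degree P0 HG].
split=> //; [exact: span_graded | exact: framed_flat HG HP |].
move=> s0 t0 st0; have HF := framed_fibre st0 HG.
have HE : sheaf_eq (span (fibre s0 t0 G)) (fibre s0 t0 (span G)).
  by apply: eq_sheaf => u; apply: iff_sym; apply: fibre_span.
have PF := HP s0 t0 st0.
by split; [apply: eq_locally_free HE (framed_locally_free PF HF)
          |apply: eq_has_degree HE (framed_has_degree PF HF)].
Qed.

End Claims.

(** * The generators of the curves *)

Lemma eq_mhomogv (k : fieldType) g n (d e : 'I_g -> nat)
    (v : 'rV[{mpoly k[g.*2]}]_n) : d =1 e -> mhomogv d v -> mhomogv e v.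
Proof. by move=> de Hv l; apply: eq_mhomog de (Hv l). Qed.
Arguments eq_mhomogv {k g n d e v} _ _.

Section Generators.
Variables (k : fieldType) (n : nat).
Local Notation R := {mpoly k[2.*2]}.
Implicit Types (i j l : 'I_n) (z : 'I_n -> k) (q : k).

Definition mono_gen g l a b : 'rV[{mpoly k[g.+1.*2]}]_n :=
  xymon k g a b *: delta_mx 0 l.

(** The generator that joins the two fixed points: it restricts to its first term
    over [1,0] and to its second over [0,1].  For [i = j] it is the generator of
    type III. *)
Definition joint_gen i j a b a' b' : 'rV[R]_n :=
  (vars k * xymon k 1 a b) *: delta_mx 0 i
  + (vart k * xymon k 1 a' b') *: delta_mx 0 j.

Lemma mono_genE g l a b l' :
  mono_gen g l a b 0 l' = if l' == l then xymon k g a b else 0.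
Proof. by rewrite !mxE eqxx /=; case: eqP => _; rewrite ?mulr1 ?mulr0. Qed.

Lemma joint_genE i j a b a' b' l :
  joint_gen i j a b a' b' 0 l =
  (if l == i then vars k * xymon k 1 a b else 0) +
  (if l == j then vart k * xymon k 1 a' b' else 0).
Proof.
by rewrite !mxE eqxx /=; do 2![case: (l =P _) => _]; rewrite ?mulr1 ?mulr0.
Qed.

Lemma mono_gen_mhomogv l a b :
  mhomogv (fun c => (a + b) * (ord0 == c))%N (mono_gen 1 l a b).
Proof.
move=> l'; rewrite mono_genE; case: eqP => _; last exact: mhomog0.
exact: xymon_mhomog.
Qed.

Lemma joint_gen_mhomogv i j a b a' b' : (a + b = a' + b')%N ->
  mhomogv (fun c => (a + b) * (ord0 == c) + (ord_max == c))%N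
    (joint_gen i j a b a' b').
Proof.
move=> ab l; rewrite joint_genE; apply: mhomogD.
  case: eqP => _; last exact: mhomog0.
  apply: eq_mhomog (mhomogM (vars_mhomog k) (xymon_mhomog k 1 a b)) => c.
  by rewrite addnC.
case: eqP => _; last exact: mhomog0.
apply: eq_mhomog (mhomogM (vart_mhomog k) (xymon_mhomog k 1 a' b')) => c.
by rewrite addnC ab.
Qed.

Lemma xymon_mono_gen g l a b a' b' :
  xymon k g a b *: mono_gen g l a' b' = mono_gen g l (a + a') (b + b').
Proof. by rewrite scalerA xymonM. Qed.

Lemma mono_gen_torus z q cs ct l a b :
  torus_act z q cs ct (mono_gen 1 l a b) = (z l * q ^+ a)%:MP *: mono_gen 1 l a b.
Proof.
apply/rowP=> l'; rewrite torus_actE [RHS]mxE !mono_genE; case: eqP => [->|_].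
  by rewrite xymon_torus -mul_mpolyC mulrA -mpolyCM.
by rewrite comp_mpoly0 scaler0 mulr0.
Qed.

(** The two terms of the generator have weights [z i * q ^+ a] and
    [z j * q ^+ a'].  Scaling [s] by the second and [t] by the first makes both
    terms scale by the product. *)
Lemma joint_gen_torus z q i j a b a' b' :
  torus_act z q (z j * q ^+ a') (z i * q ^+ a) (joint_gen i j a b a' b') =
  (z i * z j * q ^+ (a + a'))%:MP *: joint_gen i j a b a' b'.
Proof.
apply/rowP=> l; rewrite torus_actE [RHS]mxE !joint_genE -!mul_mpolyC.
set S := torus_subst _ _ _.
rewrite (raddfD (comp_mpoly S)) /= !mulrDr; congr (_ + _).
  case: eqP => [->|_]; last by rewrite comp_mpoly0 !mulr0.
  rewrite (rmorphM (comp_mpoly S)) /= xymon_torus comp_mpolyXU /= -mul_mpolyC.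
  rewrite exprD !mpolyCM; move: (xymon _ _ _ _) (vars k) => X Y; ring.
case: eqP => [->|_]; last by rewrite comp_mpoly0 !mulr0.
rewrite (rmorphM (comp_mpoly S)) /= xymon_torus comp_mpolyXU /= -mul_mpolyC.
rewrite exprD !mpolyCM; move: (xymon _ _ _ _) (vart k) => X Y; ring.
Qed.

Lemma mono_gen_specialize s0 t0 l a b :
  map_mx (specialize s0 t0) (mono_gen 1 l a b) = mono_gen 0 l a b.
Proof.
apply/rowP=> l'; rewrite mxE !mono_genE; case: eqP => _; last by rewrite raddf0.
exact: specialize_xymon.
Qed.

Lemma joint_gen_specialize s0 t0 i j a b a' b' :
  map_mx (specialize s0 t0) (joint_gen i j a b a' b') =
  s0%:MP *: mono_gen 0 i a b + t0%:MP *: mono_gen 0 j a' b'.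
Proof.
apply/rowP=> l; rewrite mxE joint_genE raddfD /= [RHS]mxE; congr (_ + _).
  rewrite [RHS]mxE mono_genE; case: eqP => _; last by rewrite raddf0 mulr0.
  by rewrite rmorphM /= specialize_s specialize_xymon.
rewrite [RHS]mxE mono_genE; case: eqP => _; last by rewrite raddf0 mulr0.
by rewrite rmorphM /= specialize_t specialize_xymon.
Qed.

End Generators.
Arguments joint_gen_specialize {k n} s0 t0 i j a b a' b'.
Arguments mono_gen_mhomogv k {n} l a b.
Arguments joint_gen_mhomogv k {n} i j {a b a' b'} _.

Section FixedIndex.
Variables (n d r : nat) (phi : triple n).
Hypothesis hphi : fixed_index d r phi.

Lemma card_tdelta : #|(tdelta phi : pred 'I_n)| = (n - r)%N.
Proof.
have [<- _ _] := hphi; rewrite -sum1_card big_mkcond; apply: eq_bigr => i _.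
have -> : (i \in (tdelta phi : pred 'I_n)) = tdelta phi i by [].
by case: (tdelta phi i).
Qed.

Lemma sum_tdelta : (\sum_(l | tdelta phi l) (ta phi l + tb phi l))%N = d.
Proof.
have [_ <- H] := hphi; rewrite [RHS](bigID (fun l => tdelta phi l)) /=.
rewrite [X in (_ + X)%N]big1 ?addn0 // => l /negbTE /H [-> ->] //.
Qed.

End FixedIndex.

(** * Types I and III *)

(** Applied to the degrees of the components, this gives the equality of degrees
    in the touched positions; the factor [i != j] covers [i = j] as well. *)
Lemma balance n (i j : 'I_n) (w w' : 'I_n -> nat) :
  (forall l, l != i -> l != j -> w l = w' l) ->
  (\sum_l w l = \sum_l w' l)%N ->
  (w i + (i != j) * w j = w' i + (i != j) * w' j)%N.
Proof.
have [<-|ij] := eqVneq i j => ww'.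
  rewrite !mul0n !addn0 (bigD1 i) //= (bigD1 i (F := w')) //=.
  by rewrite (eq_bigr w') => [/addIn|l li]; last exact: ww'.
have ji : j != i by rewrite eq_sym.
rewrite !mul1n (bigD1 i) // (bigD1 i (F := w')) //=.
rewrite (bigD1 j) // (bigD1 j (F := w')) //= (eq_bigr w').
  by rewrite !addnA => /addIn.
by move=> l /andP[li lj]; apply: ww'.
Qed.

(** Types I and III are treated together, type III being the case [i = j].  The
    sheaf is free on the fixed generators of [phi], with the one in position [i]
    replaced by [w], so that a single chart with [f = 1] suffices. *)
Section JointCurve.
Variables (k : fieldType) (n d r : nat) (phi phi' : triple n) (i j : 'I_n).
Local Notation R := {mpoly k[2.*2]}.
Local Notation a := (ta phi).
Local Notation b := (tb phi).
Local Notation a' := (ta phi').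
Local Notation b' := (tb phi').
Local Notation w := (joint_gen k i j (a i) (b i) (a' j) (b' j)).

Hypotheses (hphi : fixed_index d r phi) (hphi' : fixed_index d r phi').
Hypotheses (di : tdelta phi i) (dj' : tdelta phi' j).
Hypothesis dij : i != j -> ~~ tdelta phi j /\ ~~ tdelta phi' i.
Hypothesis same : forall l, l != i -> l != j ->
  [/\ tdelta phi l = tdelta phi' l, a l = a' l & b l = b' l].
Hypothesis distinct : i = j -> ~~ ((a i == a' i) && (b i == b' i)).
Variable G : 'rV[R]_n -> Prop.
Hypothesis HG : forall u, G u <->
  u = w \/ @fixed_gens k n 1 phi (predC (pred2 i j)) u.

Let rho : 'I_n -> 'rV[R]_n :=
  replace_row (fun l => mono_gen k 1 l (a l) (b l)) i w.

Lemma joint_balance : (a i + b i = a' j + b' j)%N.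
Proof.
have [_ Ed Hz] := hphi; have [_ Ed' Hz'] := hphi'.
have := @balance n i j (fun l => a l + b l)%N (fun l => a' l + b' l)%N.
rewrite Ed Ed' => /(_ _ erefl) H.
have {H} := H _; have [ij|ij] := eqVneq i j => H.
  rewrite !mul0n !addn0 in H; rewrite -[in RHS]ij; apply: H => l li lj.
  by case: (same li lj) => _ -> ->.
have [/negbTE /Hz [aj bj] /negbTE /Hz' [ai' bi']] := dij ij.
apply: etrans (etrans (H _) _); rewrite ?aj ?bj ?ai' ?bi' ?mul1n ?addn0 ?add0n //.
move=> l li lj.
by case: (same li lj) => _ -> ->.
Qed.

Lemma joint_rho_i : rho i = w.
Proof. by rewrite /rho /replace_row eqxx. Qed.

Lemma joint_rho_l l : l != i -> rho l = mono_gen k 1 l (a l) (b l).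
Proof. by rewrite /rho /replace_row => /negPf ->. Qed.

Lemma joint_gensE u :
  G u <-> exists l, tdelta phi l /\ u = rho l.
Proof.
apply: iff_trans (HG u) _; split=> [[->|[l [Pl dl ->]]]|[l [dl ->]]].
- by exists i; rewrite joint_rho_i.
- exists l; rewrite joint_rho_l //.
  by apply: contraTneq Pl => ->; rewrite /= eqxx.
have [->|li] := eqVneq l i; first by left; rewrite joint_rho_i.
right; exists l; split; rewrite ?joint_rho_l //= negb_or li /=.
apply: contraTneq dl => lj; have ij : i != j by rewrite -lj eq_sym.
by rewrite lj; case: (dij ij).
Qed.

Lemma joint_hom l : mhomogv
   (fun c => (a l + b l) * (ord0 == c) + (l == i) * (ord_max == c))%N (rho l).
Proof.
have [->|li] := eqVneq l i.
  rewrite joint_rho_i; apply: eq_mhomogv (joint_gen_mhomogv k i j joint_balance).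
  by move=> c; rewrite mul1n.
rewrite joint_rho_l //; apply: eq_mhomogv (mono_gen_mhomogv k l (a l) (b l)).
by move=> c; rewrite mul0n addn0.
Qed.

Lemma joint_framed :
  framed G (fun c => if c == ord0 then - d%:Z else - 1) (minors (tdelta phi) rho).
Proof.
move=> p Hp.
exists 1, (row_mat (tdelta phi) rho), (fun=> 0%N); eexists.
split; first by rewrite meval1 oner_neq0.
apply: (row_frame (mhomog1) (fun l _ => joint_hom (l := l))).
- move=> c; rewrite big_split /= -!big_distrl /= (sum_tdelta hphi).
  have -> : (\sum_(l | tdelta phi l) (l == i))%N = 1%N.
    rewrite (bigD1 i) //= eqxx big1 // => l /andP[_ /negPf ->] //.
  have [->|->] : c = ord0 \/ c = ord_max.
    by case: c => [[|[|]]] //= ?; [left|right]; apply: val_inj.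
  - by rewrite /= muln1 muln0 addn0 sub0r.
  - by rewrite /= muln0 muln1 add0n sub0r.
- by move=> l dl; apply: span_gen; apply/joint_gensE; exists l.
- by move=> u /joint_gensE Hu; rewrite scale1r; apply: span_gen.
- by move=> J; rewrite mul1r.
Qed.

(** In type III the two monomials differ, so that no coefficient can cancel. *)
Lemma two_term_neq0 (c c' : k) (t : bool) u v u' v' : c != 0 ->
  (t -> ~~ ((u == u') && (v == v'))) ->
  c%:MP * xymon k 0 u v + (if t then c'%:MP * xymon k 0 u' v' else 0) != 0.
Proof.
move=> c0 Ht; apply/eqP => /(congr1 (mcoeff
  (U_(crd0 (ord0 : 'I_1)) *+ u + U_(crd1 (ord0 : 'I_1)) *+ v)%MM)).
rewrite mcoeffD mcoeffCM mcoeff_xymon !eqxx mulr1 mcoeff0.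
case: t Ht => [/(_ isT) H|_]; last by rewrite mcoeff0 addr0 => /eqP; apply/negP.
rewrite mcoeffCM mcoeff_xymon [u' == _]eq_sym [v' == _]eq_sym (negPf H) mulr0 addr0.
by move/eqP; apply/negP.
Qed.

(** Over [s0,t0] with [s0 != 0], the minor in the columns of [phi] is nonzero; if
    [s0 = 0], then [t0 != 0] and the column [j] takes the place of [i]. *)
Lemma joint_minor_neq0 s0 t0 : ~ (s0 = 0 /\ t0 = 0) ->
  exists J, specialize s0 t0 (minors (tdelta phi) rho J) != 0.
Proof.
move=> st0.
have [th Hth] : exists th : 'I_n -> 'I_n,
  [/\ forall l, l != i -> th l = l, th i = i \/ th i = j
    & specialize s0 t0 (w 0 (th i)) != 0].
  have [s00|s00] := eqVneq s0 0; last first.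
    exists id; split=> //; first by left.
    rewrite joint_genE eqxx raddfD /= rmorphM /= specialize_s specialize_xymon.
    rewrite (fun_if (specialize s0 t0)) rmorphM /= specialize_t specialize_xymon raddf0.
    by apply: two_term_neq0 => // /eqP ij; rewrite -ij; apply: distinct.
  have t00 : t0 != 0 by apply/eqP=> t00; apply: st0.
  exists (fun l => if l == i then j else l); split; rewrite ?eqxx; last 2 first.
  - by right.
  - rewrite joint_genE eqxx addrC raddfD /= rmorphM /= specialize_t specialize_xymon.
    rewrite (fun_if (specialize s0 t0)) rmorphM /= specialize_s specialize_xymon raddf0.
    apply: two_term_neq0 => // /eqP ij; rewrite ij eq_sym [_ == b i]eq_sym.
    by have := distinct (esym ij); rewrite -ij.
  - by move=> l /negPf ->.
case: Hth => thl thi thn0.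
exists [ffun l => th (enum_val l)]; rewrite minors_diag.
  rewrite rmorph_prod /=; apply/prodf_neq0 => l dl.
  have [->|li] := eqVneq l i; first by rewrite joint_rho_i.
  by rewrite joint_rho_l // thl // mono_genE eqxx specialize_xymon xymon_neq0.
move=> l l' dl dl' ll'; have jd l1 : tdelta phi l1 -> l1 != i -> l1 != j.
  move=> dl1 l1i; apply: contraTneq dl1 => l1j.
  by rewrite l1j; apply: (dij _).1; rewrite -l1j eq_sym.
have [li|li] := eqVneq l i.
  have l'i : l' != i by rewrite -li eq_sym.
  by rewrite li joint_rho_i joint_genE thl // (negPf l'i) (negPf (jd _ dl' l'i)) addr0.
rewrite joint_rho_l // mono_genE; case: eqP => // E; case/negP: ll'.
have [l'i|l'i] := eqVneq l' i; last by rewrite -E thl.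
case: thi; rewrite -{1}l'i E => El; first by rewrite El eqxx in li.
by have := jd _ dl li; rewrite El eqxx.
Qed.

Lemma joint_claims : curve_claims d r phi phi' (- 1) (span G).
Proof.
apply: (framed_claims (card_tdelta hphi) joint_framed joint_minor_neq0).
- by move=> u /joint_gensE[l [dl ->]]; eexists; apply: joint_hom.
- apply: (@T_invariant_span k n G (fun l => (l == j)%:Z) (fun l => (l == i)%:Z)
            (a' j) (a i)) => z q z0 q0 u.
  rewrite !torus_char_delta => /HG[->|[l [_ _ ->]]].
    exists (z i * z j * q ^+ (a i + a' j)); last exact: joint_gen_torus.
    by rewrite !mulf_neq0 ?expf_neq0.
  by exists (z l * q ^+ a l); [rewrite mulf_neq0 ?expf_neq0 | apply: mono_gen_torus].
- apply: fibre_sheaf_eq => [u|p Hp].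
    move=> /HG[->|[l [_ dl ->]]].
      rewrite joint_gen_specialize mpolyC1 scale1r mpolyC0 scale0r addr0.
      by apply: span_gen; exists i.
    by rewrite mono_gen_specialize; apply: span_gen; exists l.
  exists (fun=> 0%N), 1; split; [exact: mhomog1|by rewrite meval1 oner_neq0|].
  move=> u [l [_ dl ->]]; rewrite scale1r; apply: span_gen.
  have [->|li] := eqVneq l i.
    exists w; split; first by apply/HG; left.
    by rewrite joint_gen_specialize mpolyC1 scale1r mpolyC0 scale0r addr0.
  exists (rho l); split; first by apply/joint_gensE; exists l.
  by rewrite joint_rho_l // mono_gen_specialize.
- apply: fibre_sheaf_eq => [u|p Hp].
    move=> /HG[->|[l [/= Pl dl ->]]].
      rewrite joint_gen_specialize mpolyC1 scale1r mpolyC0 scale0r add0r.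
      by apply: span_gen; exists j.
    rewrite mono_gen_specialize; apply: span_gen; exists l.
    move: Pl; rewrite negb_or => /andP[li lj].
    by have [<- <- <-] := same li lj.
  exists (fun=> 0%N), 1; split; [exact: mhomog1|by rewrite meval1 oner_neq0|].
  move=> u [l [_ dl ->]]; rewrite scale1r; apply: span_gen.
  have [->|lj] := eqVneq l j.
    exists w; split; first by apply/HG; left.
    by rewrite joint_gen_specialize mpolyC1 scale1r mpolyC0 scale0r add0r.
  have li : l != i.
    apply: contraTneq dl => li; rewrite li; apply: (dij _).2.
    by rewrite -li.
  have [El Ea Eb] := same li lj; exists (rho l); split.
    by apply/joint_gensE; exists l; rewrite El.
  by rewrite joint_rho_l // mono_gen_specialize Ea Eb.
Qed.

End JointCurve.

(** * Type II *)

(** At each end of a curve of type II, the fixed generator [h] in position [l0] is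
    replaced by two multiples of it by monomials without common zero on P^1.
    The modules differ, but the sheaves agree. *)
Lemma pencil_fibre (k : fieldType) n s0 t0 (phi : triple n) l0 c1 c2 e1 e2
    (G : 'rV[{mpoly k[2.*2]}]_n -> Prop) w1 w2 :
  let h := mono_gen k 0 l0 (ta phi l0) (tb phi l0) in
  tdelta phi l0 -> G w1 -> G w2 ->
  map_mx (specialize s0 t0) w1 = xymon k 0 c1 c2 *: h ->
  map_mx (specialize s0 t0) w2 = xymon k 0 e1 e2 *: h ->
  (forall x y : k, ~ (x = 0 /\ y = 0) ->
     x ^+ c1 * y ^+ c2 != 0 \/ x ^+ e1 * y ^+ e2 != 0) ->
  (forall u, G u -> [\/ u = w1, u = w2
     | exists l, tdelta phi l /\ u = mono_gen k 1 l (ta phi l) (tb phi l)]) ->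
  (forall l, l != l0 -> tdelta phi l -> G (mono_gen k 1 l (ta phi l) (tb phi l))) ->
  sheaf_eq (fibre s0 t0 (span G)) (fixed_sheaf k n phi).
Proof.
move=> h dl0 G1 G2 E1 E2 cover HG Gl; apply: fibre_sheaf_eq => [u|p Hp].
  have Fl l : tdelta phi l ->
      span (@fixed_gens k n 0 phi predT) (mono_gen k 0 l (ta phi l) (tb phi l)).
    by move=> dl; apply: span_gen; exists l.
  move=> /HG[->|->|[l [dl ->]]]; rewrite ?E1 ?E2 ?mono_gen_specialize.
  - exact/spanZ/Fl.
  - exact/spanZ/Fl.
  - exact: Fl.
have [x [y [fp Gh]]] : exists x y, (xymon k 0 x y).@[p] != 0 /\
    span (fibre s0 t0 G) (xymon k 0 x y *: h).
  have [|cp|ep] := cover (p (crd0 ord0)) (p (crd1 ord0)); first exact: Hp ord0.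
    exists c1, c2; rewrite xymon_eval; split=> //.
    by apply: span_gen; exists w1.
  exists e1, e2; rewrite xymon_eval; split=> //.
  by apply: span_gen; exists w2.
exists (fun c => (x + y) * (ord0 == c))%N, (xymon k 0 x y); split=> //.
  exact: xymon_mhomog.
move=> u [l [_ dl ->]]; have [->//|ll0] := eqVneq l l0.
apply/spanZ/span_gen; exists (mono_gen k 1 l (ta phi l) (tb phi l)).
by rewrite mono_gen_specialize; split=> //; apply: Gl.
Qed.

(** Both kinds of type II: [c2 = u1 = v1 = 0] for the first kind and
    [c1 = u2 = v2 = 0] for the second, while one of the remaining [u], [v] is the
    absolute value of gamma and the other one is 0.  Only the absence of common
    zeros, as expressed by [cover], matters below. *)
Section PencilCurve.
Variables (k : fieldType) (n d r : nat) (phi phi' : triple n) (i j : 'I_n).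
Variables (c1 c2 u1 u2 v1 v2 : nat).
Local Notation R := {mpoly k[2.*2]}.
Local Notation a := (ta phi).
Local Notation b := (tb phi).
Local Notation a' := (ta phi').
Local Notation b' := (tb phi').
Local Notation w :=
  (joint_gen k i j (a i + u1) (b i + u2) (a' j + v1) (b' j + v2)).

Hypotheses (hphi : fixed_index d r phi) (ij : i != j).
Hypotheses (di : tdelta phi i) (dj : tdelta phi j).
Hypothesis same_delta : tdelta phi = tdelta phi'.
Hypothesis same : forall l, l != i -> l != j -> a l = a' l /\ b l = b' l.
Hypotheses (Eai : a' i = (a i + c1)%N) (Ebi : b' i = (b i + c2)%N).
Hypotheses (Eaj : a j = (a' j + c1)%N) (Ebj : b j = (b' j + c2)%N).
Hypothesis Edeg : (a i + u1 + (b i + u2) = a' j + v1 + (b' j + v2))%N.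
Hypothesis cover : forall x y : k, ~ (x = 0 /\ y = 0) ->
  x ^+ c1 * y ^+ c2 != 0 \/
  (x ^+ u1 * y ^+ u2 != 0 /\ x ^+ v1 * y ^+ v2 != 0).
Variable G : 'rV[R]_n -> Prop.
Hypothesis HG : forall u, G u <->
  [\/ u = mono_gen k 1 i (a' i) (b' i), u = mono_gen k 1 j (a j) (b j) | u = w]
  \/ @fixed_gens k n 1 phi (predC (pred2 i j)) u.

Let rho (l : 'I_n) : 'rV[R]_n := mono_gen k 1 l (a l) (b l).

(** The common multiple of the three generators that makes type II a pencil. *)
Lemma pencil_relation :
  xymon k 1 c1 c2 *: w =
  (vars k * xymon k 1 u1 u2) *: (xymon k 1 c1 c2 *: rho i)
  + (vart k * xymon k 1 v1 v2) *: rho j.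
Proof.
rewrite /rho /joint_gen /mono_gen scalerDr !scalerA Eaj Ebj -!xymonM.
move: (xymon _ _ _ _) (xymon _ _ _ _) (xymon _ _ _ _) (xymon _ _ _ _) (xymon _ _ _ _).
by move=> X1 X2 X3 X4 X5; congr (_ *: _ + _ *: _); ring.
Qed.

Lemma pencil_curve_framed :
  framed G (fun c => if c == ord0 then - d%:Z else 0) (minors (tdelta phi) rho).
Proof.
have s_hom x y : mhomog (fun c => (ord_max == c) + (x + y) * (ord0 == c))%N
    (vars k * xymon k 1 x y).
  exact: mhomogM (vars_mhomog k) (xymon_mhomog k 1 x y).
have t_hom x y : mhomog (fun c => (ord_max == c) + (x + y) * (ord0 == c))%N
    (vart k * xymon k 1 x y).
  exact: mhomogM (vart_mhomog k) (xymon_mhomog k 1 x y).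
apply: (pencil_framed (A := tdelta phi) (i := i) (j := j) di dj ij
   (xymon_neq0 k 1 c1 c2) pencil_relation (xymon_mhomog k 1 c1 c2) (s_hom u1 u2)
   (t_hom v1 v2) (D := fun l c => ((a l + b l) * (ord0 == c))%N)
   (fun l _ => mono_gen_mhomogv k l (a l) (b l))
   (joint_gen_mhomogv k i j Edeg)).
- by move=> c; lia.
- by move=> c; rewrite Edeg Eaj Ebj; lia.
- move=> c; rewrite -big_distrl /= (sum_tdelta hphi).
  have [->|->] : c = ord0 \/ c = ord_max.
    by case: c => [[|[|]]] //= ?; [left|right]; apply: val_inj.
  - by rewrite /= muln1.
  - by rewrite /= muln0.
- move=> p Hp; have [|cp|[up vp]] := cover (x := p (crd0 ord0)) (y := p (crd1 ord0)).
  + exact: Hp ord0.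
  + by constructor 1; rewrite xymon_eval.
  have [sp|sp] := eqVneq (p (crd0 ord_max)) 0; last first.
    by constructor 2; rewrite mevalM mevalXU xymon_eval mulf_neq0.
  constructor 3; rewrite mevalM mevalXU xymon_eval mulf_neq0 //.
  by apply/eqP=> tp; apply: (Hp ord_max).
- move=> u; apply: iff_trans (HG u) _; rewrite xymon_mono_gen Eai Ebi.
  rewrite ![(c1 + _)%N]addnC ![(c2 + _)%N]addnC.
  split=> [[[->|->|->]|[l [/= Pl dl ->]]]|[->|->|->|[l [dl li lj ->]]]].
  + by constructor 1.
  + by constructor 2.
  + by constructor 3.
  + by constructor 4; exists l; move: Pl; rewrite negb_or => /andP[].
  + by left; constructor 1.
  + by left; constructor 2.
  + by left; constructor 3.
  + by right; exists l; split; rewrite //= negb_or li.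
Qed.

Lemma pencil_minor_neq0 s0 t0 :
  exists J, specialize s0 t0 (minors (tdelta phi) rho J) != 0.
Proof.
exists [ffun l => enum_val l]; rewrite (minors_diag (th := id)).
  rewrite rmorph_prod /=; apply/prodf_neq0 => l dl.
  by rewrite mono_genE eqxx specialize_xymon xymon_neq0.
by move=> l l' _ _ ll'; rewrite mono_genE eq_sym (negPf ll').
Qed.

Lemma pencil_claims : curve_claims d r phi phi' 0 (span G).
Proof.
have E1 s0 t0 := @joint_gen_specialize k n s0 t0 i j
  (a i + u1) (b i + u2) (a' j + v1) (b' j + v2).
apply: (framed_claims (card_tdelta hphi) pencil_curve_framed) => [s0 t0 _||||].
- exact: pencil_minor_neq0.
- move=> u /HG[[->|->|->]|[l [_ _ ->]]]; eexists; try exact: mono_gen_mhomogv.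
  exact: joint_gen_mhomogv Edeg.
- apply: (@T_invariant_span k n G (fun l => (l == j)%:Z) (fun l => (l == i)%:Z)
            (a' j + v1)%N (a i + u1)%N) => z q z0 q0 u.
  have zq l m : z l * q ^+ m != 0 by rewrite mulf_neq0 ?expf_neq0.
  rewrite !torus_char_delta => /HG[[->|->|->]|[l [_ _ ->]]];
    try by [eexists; last exact: mono_gen_torus].
  exists (z i * z j * q ^+ (a i + u1 + (a' j + v1))); last exact: joint_gen_torus.
  by rewrite !mulf_neq0 ?expf_neq0.
- apply: (pencil_fibre (phi := phi) (l0 := i) (c1 := c1) (c2 := c2) (e1 := u1) (e2 := u2)
            (w1 := mono_gen k 1 i (a' i) (b' i)) (w2 := w)) => //.
  + by apply/HG; left; constructor 1.
  + by apply/HG; left; constructor 3.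
  + by rewrite mono_gen_specialize xymon_mono_gen Eai Ebi addnC [(c2 + _)%N]addnC.
  + rewrite E1 mpolyC1 scale1r mpolyC0 scale0r addr0 xymon_mono_gen.
    by rewrite addnC [(u2 + _)%N]addnC.
  + by move=> x y /cover[|[]]; [left|right].
  + move=> u /HG[[->|->|->]|[l [_ dl ->]]]; [by constructor 1| |by constructor 2|].
      by constructor 3; exists j.
    by constructor 3; exists l.
  + move=> l li dl; apply/HG; have [->|lj] := eqVneq l j; first by left; constructor 2.
    by right; exists l; split; rewrite //= negb_or li.
- apply: (pencil_fibre (phi := phi') (l0 := j) (c1 := c1) (c2 := c2) (e1 := v1) (e2 := v2)
            (w1 := mono_gen k 1 j (a j) (b j)) (w2 := w)); rewrite -?same_delta //.
  + by apply/HG; left; constructor 2.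
  + by apply/HG; left; constructor 3.
  + by rewrite mono_gen_specialize xymon_mono_gen Eaj Ebj addnC [(c2 + _)%N]addnC.
  + rewrite E1 mpolyC1 scale1r mpolyC0 scale0r add0r xymon_mono_gen.
    by rewrite addnC [(v2 + _)%N]addnC.
  + by move=> x y /cover[|[]]; [left|right].
  + move=> u /HG[[->|->|->]|[l [/= Pl dl ->]]]; [|by constructor 1|by constructor 2|].
      by constructor 3; exists i.
    move: Pl; rewrite negb_or => /andP[li lj]; have [-> ->] := same li lj.
    by constructor 3; exists l.
  + move=> l lj dl; apply/HG; have [->|li] := eqVneq l i; first by left; constructor 1.
    have [<- <-] := same li lj.
    by right; exists l; split; rewrite //= negb_or li.
Qed.

End PencilCurve.

(** The two cases of gamma are united by allowing both terms of the third
    generator an additional exponent; in each case one of them is 0.  Also,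
    [a j - c] is the exponent [a' j] of the other fixed point. *)
Section ThirdGenerator.
Variables (k : fieldType) (n : nat) (phi phi' : triple n) (i j : 'I_n).
Local Notation R := {mpoly k[2.*2]}.
Local Notation a := (ta phi).
Local Notation b := (tb phi).
Local Notation a' := (ta phi').
Local Notation b' := (tb phi').
Local Notation e_ i := (delta_mx 0 i : 'rV[R]_n).

Lemma third_gen_x : b = b' ->
  (a i + b' i + (a j + b' j) = a' i + b' i + (a' j + b' j))%N -> (a i <= a' i)%N ->
  exists x y, (a i + (b i + x) = a' j + (b' j + y))%N /\
    match (a i + b i + (a' i - a i))%N%:Z - (a j + b j)%N%:Z with
    | Posz u => (vars k * xymon k 1 (a i) (b i)) *: e_ i
                + (vart k * xymon k 1 (a j - (a' i - a i)) (b j + u)) *: e_ j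
    | Negz u => (vars k * xymon k 1 (a i) (b i + u.+1)) *: e_ i
                + (vart k * xymon k 1 (a j - (a' i - a i)) (b j)) *: e_ j
    end = joint_gen k i j (a i) (b i + x) (a' j) (b j + y).
Proof.
move=> Eb Eab le_a; have -> : (a j - (a' i - a i) = a' j)%N by lia.
case E : (_ - _) => [u|u].
  by exists 0%N, u; split; [rewrite -Eb; lia | rewrite addn0].
by exists u.+1, 0%N; split; [rewrite -Eb; lia | rewrite addn0].
Qed.

Lemma third_gen_y : a = a' ->
  (a' i + b i + (a' j + b j) = a' i + b' i + (a' j + b' j))%N -> (b i <= b' i)%N ->
  exists x y, (a i + x + b i = a' j + y + b' j)%N /\
    match (a i + b i + (b' i - b i))%N%:Z - (a j + b j)%N%:Z with
    | Posz u => (vars k * xymon k 1 (a i) (b i)) *: e_ i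
                + (vart k * xymon k 1 (a j + u) (b j - (b' i - b i))) *: e_ j
    | Negz u => (vars k * xymon k 1 (a i + u.+1) (b i)) *: e_ i
                + (vart k * xymon k 1 (a j) (b j - (b' i - b i))) *: e_ j
    end = joint_gen k i j (a i + x) (b i) (a j + y) (b' j).
Proof.
move=> Ea Eab le_b; have -> : (b j - (b' i - b i) = b' j)%N by lia.
case E : (_ - _) => [u|u].
  by exists 0%N, u; split; [rewrite -Ea; lia | rewrite addn0].
by exists u.+1, 0%N; split; [rewrite -Ea; lia | rewrite addn0].
Qed.

End ThirdGenerator.

Theorem theorem4 (k : closedFieldType) (d n r : nat) (hr : (r < n)%N)
    (phi phi' : triple n)
    (hphi : fixed_index d r phi) (hphi' : fixed_index d r phi')
    (hne : phi <> phi')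
    (ty : curve_type n) (hty : has_type phi phi' ty) :
  [/\ T_invariant (curve_sheaf k n phi phi' ty),
      locally_free (curve_sheaf k n phi phi' ty) (n - r) /\
      has_degree (curve_sheaf k n phi phi' ty) (n - r)
        (fun c : 'I_2 => if c == ord0 then - d%:Z
                         else if is_typeII ty then 0 else - 1),
      sheaf_eq (fibre 1 0 (curve_sheaf k n phi phi' ty)) (fixed_sheaf k n phi),
      sheaf_eq (fibre 0 1 (curve_sheaf k n phi phi' ty)) (fixed_sheaf k n phi')
    & T_invariant_curve d r (curve_sheaf k n phi phi' ty)].
Proof.
have phi_eq : tdelta phi = tdelta phi' -> (forall l, ta phi l = ta phi' l) ->
    (forall l, tb phi l = tb phi' l) -> phi = phi'.
  case: {hphi hne hty} phi => D1 A1 B1; case: {hphi'} phi' => D2 A2 B2 /= ->.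
  by move=> /ffunP -> /ffunP ->.
have [_ Ed Hz] := hphi; have [_ Ed' Hz'] := hphi'.
case: ty hty => [i j|i j|i j|i] [same] => [[di dj' dj di']|||].
- apply: (joint_claims (i := i) (j := j) hphi hphi') => //.
  + by move=> l li lj; apply: same; rewrite /= negb_or li.
  + by move=> ij; move: dj; rewrite -ij di.
- move=> [Edel Eb ij lt_a].
  have Eab : (ta phi i + tb phi i + (ta phi j + tb phi j) =
              ta phi' i + tb phi' i + (ta phi' j + tb phi' j))%N.
    have := @balance n i j (fun l => ta phi l + tb phi l)%N
                           (fun l => ta phi' l + tb phi' l)%N.
    rewrite ij !mul1n Ed Ed'; apply=> // l li lj.
    by have [|_ -> ->] := same l; rewrite /= ?negb_or ?li.
  rewrite Eb in Eab.
  have dj : tdelta phi j.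
    by apply/negPn/negP => /negbTE /Hz [aj bj]; move: Eab lt_a; rewrite -Eb ?aj ?bj; lia.
  have di : tdelta phi i.
    rewrite Edel; apply/negPn/negP => /negbTE /Hz' [ai bi].
    by move: lt_a; rewrite ?ai ?bi.
  have [x [y [Exy Egen]]] := third_gen_x k Eb Eab (ltnW lt_a).
  rewrite -Eb in Exy Eab.
  apply: (pencil_claims (i := i) (j := j) (c1 := (ta phi' i - ta phi i)%N) (c2 := 0%N)
           (u1 := 0%N) (u2 := x) (v1 := 0%N) (v2 := y) hphi) => //; rewrite -?Eb; try lia.
  + by move=> l li lj; have [|_ -> ->] := same l; rewrite /= ?negb_or ?li.
  + move=> x0 y0 xy0; rewrite !expr0 mulr1 !mul1r.
    have [x00|x00] := eqVneq x0 0; last by left; rewrite expf_neq0.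
    have y00 : y0 != 0 by apply/eqP=> y00; apply: xy0.
    by right; rewrite !expf_neq0.
  + move=> u; rewrite /= Egen !addn0 subnKC ?(ltnW lt_a) //.
- move=> [Edel Ea ij lt_b].
  have Eab : (ta phi i + tb phi i + (ta phi j + tb phi j) =
              ta phi' i + tb phi' i + (ta phi' j + tb phi' j))%N.
    have := @balance n i j (fun l => ta phi l + tb phi l)%N
                           (fun l => ta phi' l + tb phi' l)%N.
    rewrite ij !mul1n Ed Ed'; apply=> // l li lj.
    by have [|_ -> ->] := same l; rewrite /= ?negb_or ?li.
  rewrite Ea in Eab.
  have dj : tdelta phi j.
    by apply/negPn/negP => /negbTE /Hz [aj bj]; move: Eab lt_b; rewrite -Ea ?aj ?bj; lia.
  have di : tdelta phi i.
    rewrite Edel; apply/negPn/negP => /negbTE /Hz' [ai bi].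
    by move: lt_b; rewrite ?ai ?bi.
  have [x [y [Exy Egen]]] := third_gen_y k Ea Eab (ltnW lt_b).
  rewrite -Ea in Exy Eab.
  apply: (pencil_claims (i := i) (j := j) (c1 := 0%N) (c2 := (tb phi' i - tb phi i)%N)
           (u1 := x) (u2 := 0%N) (v1 := y) (v2 := 0%N) hphi) => //; rewrite -?Ea; try lia.
  + by move=> l li lj; have [|_ -> ->] := same l; rewrite /= ?negb_or ?li.
  + move=> x0 y0 xy0; rewrite !expr0 !mulr1 !mul1r.
    have [y00|y00] := eqVneq y0 0; last by left; rewrite expf_neq0.
    have x00 : x0 != 0 by apply/eqP=> x00; apply: xy0.
    by right; rewrite !expf_neq0.
  + move=> u; rewrite /= Egen !addn0 subnKC ?(ltnW lt_b) //.
- move=> Edel.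
  have same' l : l != i -> ta phi l = ta phi' l /\ tb phi l = tb phi' l.
    by move=> li; have [] := same l li.
  have di : tdelta phi i.
    apply/negP => /negP/negbTE di; apply: hne; apply: phi_eq => // l.
      have [->|/same' []//] := eqVneq l i.
      by have [-> _] := Hz _ di; rewrite Edel in di; have [-> _] := Hz' _ di.
    have [->|/same' []//] := eqVneq l i.
    by have [_ ->] := Hz _ di; rewrite Edel in di; have [_ ->] := Hz' _ di.
  apply: (joint_claims (i := i) (j := i) hphi hphi') => //.
  + by rewrite -Edel.
  + by rewrite eqxx.
  + by move=> l li _; apply: same.
  + move=> _; apply/negP => /andP[/eqP Ea /eqP Eb]; apply: hne; apply: phi_eq => // l;
      by have [->|/same' []] := eqVneq l i.
  + move=> u; rewrite /joint_gen -scalerDl; split=> -[->|[l [Pl dl ->]]].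
    * by left.
    * by right; exists l; split; rewrite //= orbb.
    * by left.
    * by right; exists l; split=> //; move: Pl; rewrite /= orbb.
Qed.
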